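(* The following assertions hold. (i) If $E$ is an infinite-dimensional Banach space (over $\mathbb{R}$ or $\mathbb{C}$) with the primary factorisation property, then $\mathcal{B}(E)$ is Dedekind-infinite. (ii) The preceding conclusion cannot in general be strengthened to proper infiniteness: the Banach space $C[0,\omega_1]$ has the primary factorisation property, but $\mathcal{B}(C[0,\omega_1])$ is not properly infinite. (iii) Let $E$ be a non-zero complex Banach space with the primary factorisation property, and let $A_E=\mathcal{B}(E)/\mathcal{M}_E$. Then for every non-zero $a\in A_E$ there are $b,c\in A_E$ with $bac=1_{A_E}$. Consequently, $A_E$ is purely infinite if and only if $A_E\not\simeq\mathbb{C}$.
   Context: For a Banach space $E$, $\mathcal{B}(E)$ denotes the Banach algebra of bounded linear operators on $E$ and $\mathrm{Id}_E$ the identity operator. The operator $\mathrm{Id}_E$ factors through $T\in\mathcal{B}(E)$ if there are $U,V\in\mathcal{B}(E)$ with $UTV=\mathrm{Id}_E$. $E$ has the primary factorisation property (PFP) if for every $T\in\mathcal{B}(E)$ the identity $\mathrm{Id}_E$ factors through $T$ or through $\mathrm{Id}_E-T$. Put $\mathcal{M}_E=\{T\in\mathcal{B}(E): \mathrm{Id}_E \text{ does not factor through } T\}$. When $E\neq\{0\}$ has the PFP, $\mathcal{M}_E$ is a closed two-sided ideal of $\mathcal{B}(E)$ (the largest proper one), so $\mathcal{B}(E)/\mathcal{M}_E$ is a unital Banach algebra. $C[0,\omega_1]$ is the Banach space, with the supremum norm, of (complex-valued) continuous functions on the ordinal interval $[0,\omega_1]$ with its order topology, where $\omega_1$ is the first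 uncountable ordinal. Let $A$ be a unital algebra. Idempotents $p,q\in A$ are (algebraically Murray--von Neumann) equivalent, $p\sim q$, if there are $x,y\in A$ with $p=xy$ and $q=yx$; they are orthogonal if $pq=0=qp$. $A$ is Dedekind-infinite if there are $a,b\in A$ with $ab=1_A$ and $ba\neq 1_A$. $A$ is properly infinite if there are orthogonal idempotents $p,q\in A$ with $p\sim 1_A\sim q$. A unital complex Banach algebra $A$ is purely infinite if $A\not\simeq\mathbb{C}$ and for every non-zero $a\in A$ there exist $b,c\in A$ with $bac=1_A$. *)

(* Defs.v *)
From HB Require Import structures.
From mathcomp Require Import all_boot all_order all_algebra.
From mathcomp Require Import all_classical all_reals all_analysis.
From mathcomp Require Import complex wochoice lra.

Set Implicit Arguments.
Unset Strict Implicit.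
Unset Printing Implicit Defensive.

Import Order.TTheory GRing.Theory Num.Theory.
Import numFieldNormedType.Exports.

Local Open Scope classical_set_scope.
Local Open Scope ring_scope.

(* K is meant to be a realType R or its complexification R[i]. *)
Section BoundedOperators.
Context {K : numFieldType} (E : normedModType K).

Definition bounded_linear : {pred E -> E} := fun f =>
  `[< linear f /\ exists M : K, forall x, `|f x| <= M * `|x| >].

Record boundedOp := BoundedOp {
  boundedOp_fun :> E -> E;
  _ : boundedOp_fun \in bounded_linear }.

HB.instance Definition _ := [isSub for boundedOp_fun].
HB.instance Definition _ := [Choice of boundedOp by <:].

Lemma bounded_linearP (f : E -> E) :
  reflect (linear f /\ exists2 M : K, 0 <= M & forall x, `|f x| <= M * `|x|)
          (f \in bounded_linear).
Proof.
apply: (iffP (asboolP _)) => -[lf]; last by case=> M _ h; split => //; exists M.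
case=> M fM; split => //; have [[x x0]|/forallNP E0] := pselect (exists x : E, x != 0).
  exists M => //; have nx : 0 < `|x| by rewrite normr_gt0.
  by rewrite -(pmulr_lge0 _ nx); apply: le_trans (fM x).
exists 0 => // x; have /negP := E0 x; rewrite negbK => /eqP ->.
have /= := fM 0; by rewrite normr0 !mulr0.
Qed.

Lemma boundedOp_linear (T : boundedOp) : linear T.
Proof. by case: T => f /= /bounded_linearP[]. Qed.

Lemma boundedOp_bounded (T : boundedOp) :
  exists2 M : K, 0 <= M & forall x, `|T x| <= M * `|x|.
Proof. by case: T => f /= /bounded_linearP[]. Qed.

Lemma boundedOp_ext (S T : boundedOp) : S =1 T -> S = T.
Proof. by move=> ST; apply/val_inj/funext. Qed.

Fact bounded_linear_submod : GRing.submod_closed bounded_linear.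
Proof.
split=> [|a f g /bounded_linearP[lf [M M0 fM]] /bounded_linearP[lg [N N0 gN]]].
  apply/bounded_linearP; split=> [b x y|]; first by rewrite /= scaler0 addr0.
  by exists 0 => // x; rewrite normr0 mul0r.
apply/bounded_linearP; split=> [b x y|].
  rewrite !fctE lf lg !scalerDr !scalerA [a * b]mulrC.
  by rewrite -!addrA; congr (_ + _); rewrite addrCA.
exists (`|a| * M + N) => [|x]; first by rewrite addr_ge0 ?mulr_ge0.
rewrite !fctE (le_trans (ler_normD _ _))// mulrDl lerD// normrZ -mulrA.
by rewrite ler_wpM2l.
Qed.

HB.instance Definition _ :=
  GRing.isSubmodClosed.Build K (E -> E) bounded_linear bounded_linear_submod.
HB.instance Definition _ := [SubChoice_isSubLmodule of boundedOp by <:].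

Fact bounded_linear_id : idfun \in bounded_linear.
Proof.
by apply/bounded_linearP; split=> //; exists 1 => // x; rewrite mul1r.
Qed.

Fact bounded_linear_comp (S T : boundedOp) : S \o T \in bounded_linear.
Proof.
apply/bounded_linearP; split=> [a x y|] /=; first by rewrite !boundedOp_linear.
have [[M M0 SM] [N N0 TN]] := (boundedOp_bounded S, boundedOp_bounded T).
exists (M * N) => [|x]; first exact: mulr_ge0.
by rewrite (le_trans (SM _))// -mulrA ler_wpM2l.
Qed.

Definition boundedOp_one := BoundedOp bounded_linear_id.
Definition boundedOp_mul (S T : boundedOp) := BoundedOp (bounded_linear_comp S T).

Fact boundedOp_mulA : associative boundedOp_mul.
Proof. by move=> S T U; apply: boundedOp_ext. Qed.
Fact boundedOp_mul1l : left_id boundedOp_one boundedOp_mul.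
Proof. by move=> S; apply: boundedOp_ext. Qed.
Fact boundedOp_mul1r : right_id boundedOp_one boundedOp_mul.
Proof. by move=> S; apply: boundedOp_ext. Qed.
Fact boundedOp_mulDl : left_distributive boundedOp_mul +%R.
Proof. by move=> S T U; apply: boundedOp_ext. Qed.
Fact boundedOp_mulDr : right_distributive boundedOp_mul +%R.
Proof.
move=> S T U; apply: boundedOp_ext => x.
by have := boundedOp_linear S 1 (T x) (U x); rewrite !scale1r.
Qed.

HB.instance Definition _ := GRing.Zmodule_isPzRing.Build boundedOp
  boundedOp_mulA boundedOp_mul1l boundedOp_mul1r boundedOp_mulDl boundedOp_mulDr.

Lemma boundedOp_scaleAl (a : K) (S T : boundedOp) : a *: (S * T) = a *: S * T.
Proof. exact: boundedOp_ext. Qed.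

Lemma boundedOp_scaleAr (a : K) (S T : boundedOp) : a *: (S * T) = S * (a *: T).
Proof.
apply: boundedOp_ext => x.
have /= S0 : S 0 = 0.
  by have := boundedOp_linear S (-1) 0 0; rewrite scaler0 addr0 scaleN1r addNr.
by have := boundedOp_linear S a (T x) 0; rewrite S0 !addr0 => /esym.
Qed.

Definition infinite_dimensional :=
  ~ exists (n : nat) (e : 'I_n -> E),
      forall x, exists c : 'I_n -> K, x = \sum_i c i *: e i.

End BoundedOperators.

Section Infiniteness.
Context (A : pzRingType).
Implicit Types p q : A.

Definition idempotent_elt p := p * p = p.

Definition mvn_equiv p q := exists x y : A, p = x * y /\ q = y * x.

Definition dedekind_infinite := exists a b : A, a * b = 1 /\ b * a <> 1.

Definition properly_infinite := exists p q : A,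
  [/\ idempotent_elt p, idempotent_elt q, p * q = 0, q * p = 0
    & mvn_equiv p 1 /\ mvn_equiv 1 q].

End Infiniteness.

Section PrimaryFactorisation.
Context {K : numFieldType} (E : completeNormedModType K).
Local Notation B := (boundedOp E).

Definition id_factors_through (T : B) := exists U V : B, U * T * V = 1.

Definition PFP := forall T : B,
  id_factors_through T \/ id_factors_through (1 - T).

(* The operators through which the identity does not factor. *)
Definition calM : {pred B} := fun T => `[< ~ id_factors_through T >].

Lemma calMN T : (- T \in calM) = (T \in calM).
Proof.
apply/asboolP/asboolP => nT [U [V UV]]; apply: nT; exists (- U), V.
  by rewrite mulrNN.
by rewrite mulNr -mulrN.
Qed.

Lemma calM_mulr T S : T \in calM -> T * S \in calM.
Proof.
by move=> /asboolP nT; apply/asboolP => -[U [V h]]; apply: nT; exists U, (S * V);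
   rewrite mulrA -(mulrA U).
Qed.

Lemma calM_mull T S : T \in calM -> S * T \in calM.
Proof.
by move=> /asboolP nT; apply/asboolP => -[U [V h]]; apply: nT; exists (U * S), V;
   rewrite -(mulrA U).
Qed.

Lemma calMZ a T : T \in calM -> a *: T \in calM.
Proof.
move=> /asboolP nT; apply/asboolP => -[U [V h]]; apply: nT; exists (a *: U), V.
by rewrite -boundedOp_scaleAl boundedOp_scaleAr.
Qed.

Lemma calMD S T : PFP -> S \in calM -> T \in calM -> S + T \in calM.
Proof.
move=> EP /asboolP nS /asboolP nT; apply/asboolP => -[U [V h]].
have [[X [Y XY]]|[X [Y XY]]] := EP (U * S * V).
  by apply: nS; exists (X * U), (V * Y); rewrite !mulrA in XY *.
have hT : 1 - U * S * V = U * T * V.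
  by rewrite -h mulrDr mulrDl addrAC subrr add0r.
by apply: nT; exists (X * U), (V * Y); rewrite hT !mulrA in XY *.
Qed.

Lemma calM0 : (exists x : E, x != 0) -> 0 \in calM.
Proof.
move=> [x /eqP x0]; apply/asboolP => -[U [V]]; rewrite mulr0 mul0r.
by move=> /(congr1 (fun T : B => T x)) h; apply: x0; exact: esym h.
Qed.

Lemma calM1 : 1 \notin calM.
Proof. by apply/negP => /asboolP; apply; exists 1, 1; rewrite !mulr1. Qed.

End PrimaryFactorisation.
Arguments calM {K} E.

Section QuotientAlgebra.
Local Open Scope quotient_scope.
Context {K : numFieldType} (E : completeNormedModType K).
Context (E0 : exists x : E, x != 0) (EP : PFP E).
Local Notation B := (boundedOp E).

(* The quotient makes sense because, under E0 and EP, calM E is a proper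
   two-sided ideal; it is presented by the congruence S - T \in calM E. *)
Definition eq_mod_calM : rel B := fun S T => S - T \in calM E.

Fact eq_mod_calM_refl : reflexive eq_mod_calM.
Proof. by move=> S; rewrite /eq_mod_calM subrr calM0. Qed.
Fact eq_mod_calM_sym : symmetric eq_mod_calM.
Proof. by move=> S T; rewrite /eq_mod_calM -calMN opprB. Qed.
Fact eq_mod_calM_trans : transitive eq_mod_calM.
Proof.
move=> T S U ST TU; rewrite /eq_mod_calM -(subrKA T); exact: calMD.
Qed.

Canonical eq_mod_calM_equiv :=
  EquivRel eq_mod_calM eq_mod_calM_refl eq_mod_calM_sym eq_mod_calM_trans.

Definition quotAlg : Type := {eq_quot eq_mod_calM_equiv}.

HB.instance Definition _ := Choice.on quotAlg.
HB.instance Definition _ := EqQuotient.on quotAlg.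

Lemma quotAlgP (S T : B) : \pi_quotAlg S = \pi_quotAlg T <-> S - T \in calM E.
Proof. by split=> [/eqmodP|h]; last apply/eqmodP. Qed.

Lemma quotAlg_ind (P : quotAlg -> Prop) : (forall T, P (\pi_quotAlg T)) -> forall a, P a.
Proof. by move=> Ppi a; rewrite -[a]reprK. Qed.

Lemma quotAlg_repr (T : B) : T - repr (\pi_quotAlg T) \in calM E.
Proof. by apply/quotAlgP; rewrite reprK. Qed.

Definition quotAlg_zero : quotAlg := \pi_quotAlg 0.
Definition quotAlg_one : quotAlg := \pi_quotAlg 1.
Definition quotAlg_opp (a : quotAlg) : quotAlg := \pi_quotAlg (- repr a).
Definition quotAlg_add (a b : quotAlg) : quotAlg := \pi_quotAlg (repr a + repr b).
Definition quotAlg_mul (a b : quotAlg) : quotAlg := \pi_quotAlg (repr a * repr b).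
Definition quotAlg_scale (k : K) (a : quotAlg) : quotAlg := \pi_quotAlg (k *: repr a).

Fact pi_opp T : \pi_quotAlg (- T) = quotAlg_opp (\pi_quotAlg T).
Proof. by apply/quotAlgP; rewrite -opprD calMN quotAlg_repr. Qed.

Fact pi_add S T : \pi_quotAlg (S + T) = quotAlg_add (\pi_quotAlg S) (\pi_quotAlg T).
Proof. by apply/quotAlgP; rewrite opprD addrACA calMD ?quotAlg_repr. Qed.

Fact pi_mul S T : \pi_quotAlg (S * T) = quotAlg_mul (\pi_quotAlg S) (\pi_quotAlg T).
Proof.
apply/quotAlgP; set S' := repr (\pi_quotAlg S); set T' := repr (\pi_quotAlg T).
have -> : S * T - S' * T' = (S - S') * T + S' * (T - T').
  by rewrite mulrBl mulrBr subrKA.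
by apply: calMD => //; [apply: calM_mulr|apply: calM_mull]; exact: quotAlg_repr.
Qed.

Fact pi_scale k T : \pi_quotAlg (k *: T) = quotAlg_scale k (\pi_quotAlg T).
Proof. by apply/quotAlgP; rewrite -scalerBr calMZ ?quotAlg_repr. Qed.

Fact quotAlg_addA : associative quotAlg_add.
Proof.
by elim/quotAlg_ind=> S; elim/quotAlg_ind=> T; elim/quotAlg_ind=> U;
   rewrite -!pi_add addrA.
Qed.
Fact quotAlg_addC : commutative quotAlg_add.
Proof.
by elim/quotAlg_ind=> S; elim/quotAlg_ind=> T; rewrite -!pi_add addrC.
Qed.
Fact quotAlg_add0 : left_id quotAlg_zero quotAlg_add.
Proof. by elim/quotAlg_ind=> S; rewrite -pi_add add0r. Qed.
Fact quotAlg_addN : left_inverse quotAlg_zero quotAlg_opp quotAlg_add.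
Proof. by elim/quotAlg_ind=> S; rewrite -pi_opp -pi_add addNr. Qed.

HB.instance Definition _ := GRing.isZmodule.Build quotAlg
  quotAlg_addA quotAlg_addC quotAlg_add0 quotAlg_addN.

Fact quotAlg_mulA : associative quotAlg_mul.
Proof.
by elim/quotAlg_ind=> S; elim/quotAlg_ind=> T; elim/quotAlg_ind=> U;
   rewrite -!pi_mul mulrA.
Qed.
Fact quotAlg_mul1l : left_id quotAlg_one quotAlg_mul.
Proof. by elim/quotAlg_ind=> S; rewrite -pi_mul mul1r. Qed.
Fact quotAlg_mul1r : right_id quotAlg_one quotAlg_mul.
Proof. by elim/quotAlg_ind=> S; rewrite -pi_mul mulr1. Qed.
Fact quotAlg_mulDl : left_distributive quotAlg_mul quotAlg_add.
Proof.
by elim/quotAlg_ind=> S; elim/quotAlg_ind=> T; elim/quotAlg_ind=> U;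
   rewrite -pi_add -!pi_mul -pi_add mulrDl.
Qed.
Fact quotAlg_mulDr : right_distributive quotAlg_mul quotAlg_add.
Proof.
by elim/quotAlg_ind=> S; elim/quotAlg_ind=> T; elim/quotAlg_ind=> U;
   rewrite -pi_add -!pi_mul -pi_add mulrDr.
Qed.
Fact quotAlg_one_neq0 : quotAlg_one != quotAlg_zero.
Proof.
by apply/eqP => /quotAlgP; rewrite subr0 (negbTE (calM1 E)).
Qed.

HB.instance Definition _ := GRing.Zmodule_isNzRing.Build quotAlg
  quotAlg_mulA quotAlg_mul1l quotAlg_mul1r quotAlg_mulDl quotAlg_mulDr
  quotAlg_one_neq0.

Fact quotAlg_scaleA a b v :
  quotAlg_scale a (quotAlg_scale b v) = quotAlg_scale (a * b) v.
Proof. by elim/quotAlg_ind: v => S; rewrite -!pi_scale scalerA. Qed.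
Fact quotAlg_scale1 : left_id 1 quotAlg_scale.
Proof. by elim/quotAlg_ind=> S; rewrite -!pi_scale scale1r. Qed.
Fact quotAlg_scaleDr : right_distributive quotAlg_scale +%R.
Proof.
by move=> k; elim/quotAlg_ind=> S; elim/quotAlg_ind=> T;
   rewrite -[LHS]/(quotAlg_scale _ (quotAlg_add _ _)) -pi_add -!pi_scale
     scalerDr pi_add.
Qed.
Fact quotAlg_scaleDl v : {morph quotAlg_scale^~ v : a b / a + b}.
Proof.
by move=> a b; elim/quotAlg_ind: v => S; rewrite -!pi_scale scalerDl pi_add.
Qed.

HB.instance Definition _ := GRing.Zmodule_isLmodule.Build K quotAlg
  quotAlg_scaleA quotAlg_scale1 quotAlg_scaleDr quotAlg_scaleDl.

Fact quotAlg_scaleAl k (u v : quotAlg) : k *: (u * v) = k *: u * v.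
Proof.
elim/quotAlg_ind: u => S; elim/quotAlg_ind: v => T.
rewrite -[LHS]/(quotAlg_scale k (quotAlg_mul _ _)).
rewrite -[RHS]/(quotAlg_mul (quotAlg_scale k _) _).
by rewrite -pi_mul -!pi_scale -pi_mul boundedOp_scaleAl.
Qed.
Fact quotAlg_scaleAr k (u v : quotAlg) : k *: (u * v) = u * (k *: v).
Proof.
elim/quotAlg_ind: u => S; elim/quotAlg_ind: v => T.
rewrite -[LHS]/(quotAlg_scale k (quotAlg_mul _ _)).
rewrite -[RHS]/(quotAlg_mul _ (quotAlg_scale k _)).
by rewrite -pi_mul -!pi_scale -pi_mul boundedOp_scaleAr.
Qed.

HB.instance Definition _ := GRing.Lmodule_isLalgebra.Build K quotAlg quotAlg_scaleAl.
HB.instance Definition _ := GRing.Lalgebra_isAlgebra.Build K quotAlg quotAlg_scaleAr.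

End QuotientAlgebra.

Lemma inj_countable T U (A : set T) (B : set U) (h : T -> U) :
  (forall x, A x -> B (h x)) -> (forall x y, A x -> A y -> h x = h y -> x = y) ->
  countable B -> countable A.
Proof.
move=> hAB hinj /countable_injP[f finj]; apply/countable_injP; exists (f \o h).
move=> x y /set_mem Ax /set_mem Ay /= fh; apply: hinj => //.
by apply: finj => //; apply/mem_set/hAB.
Qed.

Section Omega1.

(* A well-ordering of an uncountable type. *)
Definition wo_uncountable : rel (nat -> bool) :=
  sval (well_ordering_principle (nat -> bool)).

Local Notation wo := wo_uncountable.

Lemma wo_wo : well_order wo.
Proof. exact: svalP (well_ordering_principle (nat -> bool)). Qed.

Lemma wo_min (A : set (nat -> bool)) : A !=set0 ->
  exists2 x, A x & forall y, A y -> wo x y.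
Proof.
move=> [a Aa]; have [|x [[xA xm] _]] := @wo_wo (fun x => `[< A x >]).
  by exists a; apply/asboolP.
by exists x; [apply/asboolP|move=> y Ay; apply: xm; apply/asboolP].
Qed.

Lemma wo_total x y : wo x y \/ wo y x.
Proof.
have [|z [->|->] h] := @wo_min [set x; y]; first by exists x; left.
  by left; apply: h; right.
by right; apply: h; left.
Qed.

Lemma wo_refl x : wo x x. Proof. by case: (wo_total x x). Qed.

Lemma wo_anti x y : wo x y -> wo y x -> x = y.
Proof.
move=> xy yx; pose A : pred _ := fun z => `[< z = x \/ z = y >].
have [|z [_ zu]] := @wo_wo A; first by exists x; apply/asboolP; left.
have Am u : u = x \/ u = y -> minimum_of wo A u.
  move=> uA; split; first exact/asboolP.
  by move=> v /asboolP vA; case: uA => ->; case: vA => ->; rewrite ?wo_refl.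
by rewrite -(zu _ (Am x (or_introl erefl))) -(zu _ (Am y (or_intror erefl))).
Qed.

Lemma wo_trans y x z : wo x y -> wo y z -> wo x z.
Proof.
move=> xy yz; have [|u Au um] := @wo_min [set u | u = x \/ u = y \/ u = z].
  by exists x; left.
have xz := um z (or_intror (or_intror erefl)).
have uy := um y (or_intror (or_introl erefl)).
have ux := um x (or_introl erefl).
case: Au => [<-//|[uE|uE]]; subst u.
  by rewrite (wo_anti xy ux).
by rewrite (wo_anti yz uy) in xy *.
Qed.

(* The points of a well-ordered uncountable set whose initial segments are
   countable: an uncountable well-ordered set all of whose proper initial
   segments are countable, that is, the ordinal omega_1. *)
Record omega1 := MkOmega1 {
  omega1_val : nat -> bool;
  omega1_valP : `[< countable [set y | wo y omega1_val] >] }.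

HB.instance Definition _ := [isSub for omega1_val].
HB.instance Definition _ := [Choice of omega1 by <:].

(* The ordinal interval [0, omega_1]: None is the last element omega_1. *)
Definition omega1_itv := option omega1.

HB.instance Definition _ := Choice.on omega1_itv.

Definition omega1_itv_le (a b : omega1_itv) : bool :=
  match a, b with
  | _, None => true
  | None, Some _ => false
  | Some x, Some y => wo (val x) (val y)
  end.

Definition omega1_itv_lt (a b : omega1_itv) : bool := (b != a) && omega1_itv_le a b.

Definition omega1_itv_meet a b := if omega1_itv_lt a b then a else b.
Definition omega1_itv_join a b := if omega1_itv_lt a b then b else a.

Fact omega1_itv_anti : antisymmetric omega1_itv_le.
Proof.
move=> [x|] [y|] //= /andP[xy yx]; congr Some.
exact/val_inj/wo_anti.
Qed.

Fact omega1_itv_trans : transitive omega1_itv_le.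
Proof. by move=> [y|] [x|] [z|] //=; apply: wo_trans. Qed.

Fact omega1_itv_total : total omega1_itv_le.
Proof. by move=> [x|] [y|] //=; apply/orP/wo_total. Qed.

Fact omega1_display : Order.disp_t. Proof. exact: Order.Disp tt tt. Qed.

HB.instance Definition _ := Order.isOrder.Build omega1_display omega1_itv
  (fun _ _ => erefl) (fun _ _ => erefl) (fun _ _ => erefl)
  omega1_itv_anti omega1_itv_trans omega1_itv_total.

Local Open Scope order_scope.

Lemma omega1_itv_wf (A : set omega1_itv) : A !=set0 ->
  exists2 a, A a & forall b, A b -> a <= b.
Proof.
move=> A0; have [[x Ax]|nA] := pselect (exists x, A (Some x)); last first.
  exists None; last by move=> [x|] // Ax; case: nA; exists x.
  by case: A0 => -[x|] // Ax; case: nA; exists x.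
have [|v [y Ay <-] vm] := @wo_min [set val y | y in [set y | A (Some y)]].
  by exists (val x), x.
exists (Some y) => // -[z|] // Az; apply: vm; by exists z.
Qed.

Lemma countable_below (a : omega1_itv) : (a < None)%O ->
  countable [set b : omega1_itv | b <= a].
Proof.
case: a => // a _; have /asboolP ca := omega1_valP a.
apply: (@inj_countable _ _ _ _
    (fun b : omega1_itv => if b is Some x then val x else val a) _ _ ca).
  by move=> [b|].
by move=> [b|] [c|] // _ _ /val_inj ->.
Qed.

Lemma uncountable_bitseq : ~ countable [set: nat -> bool].
Proof.
move=> /countable_injP[f finj].
pose g n := ~~ `[< exists2 h, f h = n & h n >].
have gE : g (f g) = ~~ g (f g).
  rewrite {1}/g; congr (~~ _); apply/asboolP/idP => [[h fh]|gg]; last by exists g.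
  by have -> : h = g by apply: finj; rewrite ?inE.
by case: (g (f g)) gE.
Qed.

Lemma uncountable_below_None : ~ countable [set a : omega1_itv | a < None].
Proof.
move=> c; pose S := [set x | countable [set y | wo y x]].
have cS : countable S.
  apply: (@inj_countable _ _ _ _ (fun x =>
      if pselect (countable [set y | wo y x]) is left cx
      then Some (MkOmega1 (asboolT cx)) : omega1_itv else None) _ _ c).
    by move=> x Sx; case: pselect.
  move=> x y Sx Sy.
  by case: pselect => // cx; case: pselect => // cy -[].
have [ST|/existsNP nS] := pselect (forall x, S x).
  by apply: uncountable_bitseq; apply: sub_countable cS; apply: subset_card_le.
have [x nSx xm] := @wo_min (~` S) nS; apply: nSx.
have /countable_injP[f finj] := cS; apply/countable_injP.
exists (fun y => if y == x then 0 else (f y).+1)%N => y z.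
move=> /set_mem yx /set_mem zx; have xS u : wo u x -> u != x -> S u.
  move=> ux; apply: contra_neqP => nSu; apply: wo_anti => //; exact: xm.
have [->|yx'] := eqVneq y x; have [->|zx'] := eqVneq z x => //.
by move=> [] /finj; apply; apply/mem_set; apply: xS.
Qed.

End Omega1.

Section ComplexModulus.
Context (R : realType).
Implicit Types z w : R[i].

(* The absolute value of z as an element of R; `|z| lives in R[i]. *)
Definition modulus z : R := complex.Re `|z|.

Lemma modulusE z : (modulus z)%:C%C = `|z|.
Proof. by rewrite /modulus normc_def. Qed.

Lemma modulus_ge0 z : 0 <= modulus z.
Proof. by rewrite -ler0c modulusE. Qed.

Lemma ler_modulusD z w : modulus (z + w) <= modulus z + modulus w.
Proof. by rewrite -lecR rmorphD/= !modulusE ler_normD. Qed.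

Lemma modulusM z w : modulus (z * w) = modulus z * modulus w.
Proof. by apply: complexI; rewrite rmorphM/= !modulusE normrM. Qed.

Lemma modulus0 : modulus 0 = 0. Proof. by rewrite /modulus normr0. Qed.

Lemma modulus_eq0 z : modulus z = 0 -> z = 0.
Proof. by move=> z0; apply/eqP; rewrite -normr_eq0 -modulusE z0. Qed.

Lemma complex_gt0E (e : R[i]) : 0 < e -> exists2 r : R, 0 < r & e = r%:C%C.
Proof.
case: e => a b; rewrite ltcE /= => /andP[/eqP -> a0]; by exists a.
Qed.

Lemma ball_complexE z w (r : R) : ball (z : R[i]^o) r%:C%C w <-> modulus (z - w) < r.
Proof. by rewrite -ball_normE /= -modulusE ltcR. Qed.

Lemma modulus_le_ReIm z : modulus z <= `|complex.Re z| + `|complex.Im z|.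
Proof.
rewrite {1}[z]complexE (le_trans (ler_modulusD _ _))// lerD//.
  by rewrite /modulus normc_def/= expr0n addr0 sqrtr_sqr.
by rewrite modulusM /modulus !normc_def /= !expr0n/= expr1n add0r addr0 sqrtr1
  mul1r sqrtr_sqr.
Qed.

Lemma Re_le_modulus z : `|complex.Re z| <= modulus z.
Proof.
by case: z => a b; rewrite /modulus normc_def/= -sqrtr_sqr ler_wsqrtr// lerDl sqr_ge0.
Qed.

Lemma Im_le_modulus z : `|complex.Im z| <= modulus z.
Proof.
by case: z => a b; rewrite /modulus normc_def/= -sqrtr_sqr ler_wsqrtr// lerDr sqr_ge0.
Qed.

Lemma modulusN z : modulus (- z) = modulus z.
Proof. by rewrite /modulus normrN. Qed.

Lemma modulus_distC z w : modulus (z - w) = modulus (w - z).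
Proof. by rewrite /modulus distrC. Qed.

Lemma ReB z w : complex.Re (z - w) = complex.Re z - complex.Re w.
Proof. by case: z; case: w. Qed.

Lemma ImB z w : complex.Im (z - w) = complex.Im z - complex.Im w.
Proof. by case: z; case: w. Qed.

Lemma complex_complete (F : set_system R[i]^o) {FF : ProperFilter F} :
  cauchy F -> exists l : R[i]^o, F --> l.
Proof.
move=> /cauchy_ballP cF.
have cc (p : R[i] -> R) : (forall z w, `|p z - p w| <= modulus (z - w)) ->
    exists l, (p @ F) --> (l : R).
  move=> pl; have : cauchy (p @ F).
    apply/cauchy_ballP => e e0.
    have := cF e%:C%C; rewrite ltcR => /(_ e0) [[A B] [/= FA FB]] AB.
    exists (p @` A, p @` B) => /=.
      by split; [apply: filterS FA|apply: filterS FB] => z Az; exists z.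
    move=> [_ _] [/= [z Az <-] [w Bw <-]]; rewrite -ball_normE /=.
    apply: le_lt_trans (pl _ _) _; apply/ball_complexE; exact: (AB (z, w)).
  by move=> /cauchy_cvg/cvg_ex.
have [|a Fa] := cc (@complex.Re R).
  by move=> z w; rewrite -ReB Re_le_modulus.
have [|b Fb] := cc (@complex.Im R).
  by move=> z w; rewrite -ImB Im_le_modulus.
exists (a +i* b)%C; apply/cvgrPdist_lt => _ /complex_gt0E[e e0 ->].
have e20 : 0 < e / 2 by rewrite divr_gt0.
move/cvgrPdist_lt: Fa => /(_ _ e20) Fa; move/cvgrPdist_lt: Fb => /(_ _ e20) Fb.
near=> z; rewrite -modulusE ltcR (le_lt_trans (modulus_le_ReIm _))//.
rewrite ReB ImB /=.
by rewrite [e]splitr ltrD//; near: z.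
Unshelve. all: by end_near. Qed.

End ComplexModulus.

Section ContinuousPred.
Context {K : numFieldType} {X : topologicalType} {V : normedModType K}.

Definition continuous_pred : {pred X -> V} := fun f => `[< continuous f >].

Fact continuous_submod : GRing.submod_closed continuous_pred.
Proof.
split=> [|a f g /asboolP cf /asboolP cg]; apply/asboolP => x.
  exact: (@cst_continuous X V 0 x).
apply: (@continuousD K V X (a \*: f) g x _ (cg x)).
exact: cvgZr (cf x).
Qed.

HB.instance Definition _ :=
  GRing.isSubmodClosed.Build K (X -> V) continuous_pred continuous_submod.

End ContinuousPred.

Section ContinuousFunctions.
Context (R : realType).
Local Notation X := (order_topology omega1_itv).

(* The complex-valued continuous functions on [0, omega_1]. *)
Record C_omega1 := MkC_omega1 {
  C_omega1_fun :> X -> R[i]^o;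
  _ : C_omega1_fun \in continuous_pred }.

HB.instance Definition _ := [isSub for C_omega1_fun].
HB.instance Definition _ := [Choice of C_omega1 by <:].
HB.instance Definition _ := [SubChoice_isSubLmodule of C_omega1 by <:].

Lemma C_omega1_continuous (f : C_omega1) : continuous f.
Proof. by case: f => f /= /asboolP. Qed.

Lemma C_omega1_bounded (f : C_omega1) : exists M : R, forall x, modulus (f x) <= M.
Proof.
pose A := [set a : omega1_itv |
  ~ exists M : R, forall b : omega1_itv, (b <= a)%O -> modulus (f b) <= M].
have [A0|A0] := pselect (A !=set0); last first.
  have [M fM] : exists M : R, forall b : omega1_itv,
      (b <= None :> omega1_itv)%O -> modulus (f b) <= M.
    by apply: contrapT => h; apply: A0; exists None.
  by exists M => x; apply: fM; case: x.
have [a Aa am] := omega1_itv_wf A0; exfalso; apply: Aa.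
have fa : nbhs (a : X) [set x | `|f a - f x| < 1%:C%C].
  have /cvgrPdist_lt := @C_omega1_continuous f a.
  by apply; rewrite ltcR ltr01.
rewrite order_nbhs_itv in fa; case: fa => -[l r] [lr].
rewrite itv_boundlr => /andP[la ar] fi.
have fb b : (l <= BLeft b)%O -> (b <= a)%O -> modulus (f b) <= modulus (f a) + 1.
  move=> lb ba; have := fi b; rewrite /= itv_boundlr lb /=.
  have -> : (BRight b <= r)%O by apply: le_trans ar; rewrite bnd_simp.
  move=> /(_ isT); rewrite -modulusE ltcR => /ltW fab.
  rewrite -[f b](subrK (f a)) addrC (le_trans (ler_modulusD _ _))// lerD//.
  by rewrite modulus_distC.
case: l lr la fi fb => [[] c|[]] //.
- move=> _; rewrite bnd_simp => ca _ fb.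
  have [M fM] : exists M : R, forall b : omega1_itv, (b <= c)%O -> modulus (f b) <= M.
    by apply: contrapT => /am; rewrite leNgt ca.
  exists (Order.max M (modulus (f a) + 1)) => b ba; rewrite le_max.
  by have [bc|cb] := leP b c; [rewrite fM|rewrite fb ?orbT ?bnd_simp].
- by move=> _ _ _ fb; exists (modulus (f a) + 1) => b; exact: fb.
Qed.

Definition supnorm (f : C_omega1) : R := sup (range (fun x => modulus (f x))).

Lemma modulus_le_supnorm (f : C_omega1) x : modulus (f x) <= supnorm f.
Proof.
have [M fM] := C_omega1_bounded f.
apply: ub_le_sup; last by exists x.
by exists M => _ [y _ <-].
Qed.

Lemma supnorm_le (f : C_omega1) M : (forall x, modulus (f x) <= M) -> supnorm f <= M.
Proof.
move=> fM; apply: ge_sup; first by exists (modulus (f None)), None.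
by move=> _ [y _ <-].
Qed.

Fact ler_supnormD (f g : C_omega1) :
  (supnorm (f + g))%:C%C <= (supnorm f)%:C%C + (supnorm g)%:C%C.
Proof.
rewrite -rmorphD lecR; apply: supnorm_le => x.
by rewrite (le_trans (ler_modulusD _ _))// lerD// modulus_le_supnorm.
Qed.

Fact supnormZ (a : R[i]) (f : C_omega1) :
  (supnorm (a *: f))%:C%C = `|a| * (supnorm f)%:C%C.
Proof.
rewrite -modulusE -rmorphM/=; congr (_%:C%C); apply/eqP; rewrite eq_le.
apply/andP; split.
  apply: supnorm_le => x; rewrite [modulus _]modulusM.
  by rewrite ler_wpM2l ?modulus_ge0 ?modulus_le_supnorm.
have [->|a0] := eqVneq a 0.
  rewrite modulus0 mul0r; apply: le_trans (modulus_le_supnorm _ None).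
  exact: modulus_ge0.
have a_gt0 : 0 < modulus a.
  rewrite lt_neqAle modulus_ge0 andbT eq_sym; apply: contra_neq a0.
  exact: modulus_eq0.
rewrite -ler_pdivlMl//; apply: supnorm_le => x.
rewrite ler_pdivlMl// -modulusM; exact: (modulus_le_supnorm (a *: f)).
Qed.

Fact supnorm_eq0 (f : C_omega1) : (supnorm f)%:C%C = 0 -> f = 0.
Proof.
move=> [f0]; apply/val_inj/funext => x; apply: modulus_eq0.
by apply/eqP; rewrite eq_le modulus_ge0 -f0 modulus_le_supnorm.
Qed.

(* Norms take their values in the field of scalars, here R[i]. *)
HB.instance Definition _ :=
  Lmodule_isNormed.Build R[i] C_omega1 ler_supnormD supnormZ supnorm_eq0.

Lemma C_omega1_normE (f : C_omega1) : `|f| = (supnorm f)%:C%C.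
Proof. by []. Qed.

Fact C_omega1_complete (F : set_system C_omega1) :
  ProperFilter F -> cauchy F -> cvg F.
Proof.
move=> FF cF.
have cF1 (e : R) : 0 < e -> exists f, F [set g | supnorm (f - g) < e].
  move=> e0; have : cauchy_ex F by exact/cauchyP.
  move=> /(_ e%:C%C); rewrite ltcR => /(_ e0)[f Ff]; exists f.
  by apply: filterS Ff => g; rewrite -ball_normE /= ltcR.
have cvx x : exists l : R[i], ((fun f : C_omega1 => f x : R[i]^o) @ F) --> (l : R[i]^o).
  have cx : cauchy ((fun f : C_omega1 => f x : R[i]^o) @ F).
    apply/cauchyP => _ /complex_gt0E[e /cF1[f Ff] ->].
    exists (f x).
    suff : F [set g : C_omega1 | ball (f x : R[i]^o) e%:C%C (g x)] by [].
    apply: filterS Ff => g fg; apply/ball_complexE.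
    have fgx : modulus (f x - g x) <= supnorm (f - g) := modulus_le_supnorm (f - g) x.
    exact: le_lt_trans fgx fg.
  exact: complex_complete cx.
have [g Fg] := choice cvx.
have close (e : R) f : 0 < e -> F [set h | supnorm (f - h) < e] ->
    forall x, modulus (f x - g x) <= e + e.
  move=> e0 Ff x; have /cvgrPdist_lt/(_ e%:C%C) := Fg x; rewrite ltcR => /(_ e0) Fe.
  have [h [/= fh]] := filter_ex (filterI Ff Fe).
  rewrite -modulusE ltcR => gh.
  have -> : f x - g x = (f x - h x) + - (g x - h x) by rewrite opprB subrKA.
  rewrite (le_trans (ler_modulusD _ _))// lerD//.
    have fhx : modulus (f x - h x) <= supnorm (f - h) := modulus_le_supnorm (f - h) x.
    exact: le_trans fhx (ltW fh).
  by rewrite modulusN ltW.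
have cg : (g : X -> R[i]^o) \in continuous_pred.
  apply/asboolP => x; apply/(@cvgrPdist_lt _ _ _ (nbhs (x : X))) => _ /complex_gt0E[e e0 ->].
  have e5 : 0 < e / 5 by rewrite divr_gt0.
  have [f Ff] := cF1 _ e5; have fg := close _ _ e5 Ff.
  have /cvgrPdist_lt/(_ (e / 5)%:C%C) := @C_omega1_continuous f x.
  rewrite ltcR => /(_ e5); apply: filterS => y /=; rewrite -!modulusE !ltcR => fxy.
  have -> : g x - g y = - (f x - g x) + (f x - f y) + (f y - g y).
    by rewrite opprB !subrKA.
  rewrite (le_lt_trans (ler_modulusD _ _))//.
  have := ler_modulusD (- (f x - g x)) (f x - f y).
  have := fg x; have := fg y; rewrite modulusN.
  lra.
apply/cvg_ex; exists (MkC_omega1 cg); apply/cvgrPdist_lt => _ /complex_gt0E[e e0 ->].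
have e4 : 0 < e / 4 by rewrite divr_gt0.
have [f Ff] := cF1 _ e4; have fg := close _ _ e4 Ff.
apply: filterS Ff => h /= fh; rewrite /Num.norm/= ltcR.
apply: (@le_lt_trans _ _ (3 * (e / 4))); last by lra.
apply: supnorm_le => x.
have -> : (MkC_omega1 cg - h) x = - (f x - g x) + (f - h) x.
  by rewrite opprB /= subrKA.
rewrite (le_trans (ler_modulusD _ _))//.
have := fg x; have := modulus_le_supnorm (f - h) x; have := fh.
rewrite modulusN; lra.
Qed.

HB.instance Definition _ := Uniform_isComplete.Build C_omega1 C_omega1_complete.

End ContinuousFunctions.

Definition alg_isomorphic {K : pzRingType} (A B : algType K) :=
  exists f : {lrmorphism A -> B}, bijective f.

(* R[i]^o is the field of complex numbers as an algebra over itself.  An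
   algebra isomorphism between a Banach algebra and the complex numbers is
   automatically a homeomorphism, both being one-dimensional. *)
Definition purely_infinite {R : realType} (A : algType R[i]) :=
  ~ alg_isomorphic A R[i]^o /\
  forall a : A, a != 0 -> exists b c : A, b * a * c = 1.

(* Main.v *)
(* (i) By Hahn-Banach there is a rank-one projection P. The identity of an
   infinite-dimensional space does not factor through P, so by the PFP it
   factors through 1 - P, say U (1 - P) V = 1; then a = U (1 - P) and
   b = (1 - P) V satisfy a b = 1 and P (b a) = 0, so b a <> 1.

   (ii) Let j_x f = f(omega_1) - f(x). Every bounded operator T on
   C[0, omega_1] has a scalar lambda and a club of countable ordinals x with
   j_x (T f) = lambda j_x f for all f. The indicators of the intervals [0, b]
   span a dense subspace, so it suffices to check this on them. For fixed b,
   j_x (T 1_[0, b]) vanishes for large x, because continuous functions are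
   eventually constant; for fixed x it is eventually constant in b, because
   j_x o T is bounded. If x is a limit ordinal closed under these bounds,
   then j_x (T 1_[0, b]) is 0 for b < x and, by continuity, -lambda for
   x <= b < omega_1, where lambda is the eventual value of a function of x
   that is continuous below omega_1.
   Clubs intersect, so T |-> lambda is a character, and an algebra with a
   character is not properly infinite. If lambda <> 0, enumerate
   the club, with one point d0 removed from its bottom, as delta with left
   adjoint r. Composition with r and delta factors f |-> f - f(omega_1)
   through T up to the factor lambda, and the spare point d0 is used to
   store f(omega_1). As the scalars of T and 1 - T add up to 1, one of them
   is non-zero.

   (iii) A non-zero class of the quotient is the class of an operator through
   which the identity factors. *)
Require Import Defs.
From mathcomp Require Import all_boot all_order all_algebra.
From mathcomp Require Import all_classical all_reals all_analysis.
From mathcomp Require Import complex ring lra.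
Import Order.TTheory GRing.Theory Num.Theory.
Import numFieldNormedType.Exports.
Local Open Scope ring_scope.

(** * The Hahn-Banach theorem via minimal sublinear functionals *)

Section HahnBanach.
Local Open Scope classical_set_scope.
Context {R : realType} {K : numFieldType} (i : {rmorphism R -> K}).
Context {V : lmodType K}.
Implicit Types p q : V -> R.

(** Homogeneity is an inequality for s > 0 only; applied to s and to its inverse it gives equality.
    Real scalars act through [i], so that real and complex spaces are treated together. *)
Definition sublinear p := (forall x y, p (x + y) <= p x + p y) /\
  (forall s x, 0 < s -> p (i s *: x) <= s * p x).

Lemma sublinear0 {p} : sublinear p -> 0 <= p 0.
Proof. by case=> pD _; have := pD 0 0; rewrite addr0; lra. Qed.

Lemma sublinear_ge_opp {p} : sublinear p -> forall x, - p (- x) <= p x.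
Proof.
move=> sp x; have := sublinear0 sp; case: sp => pD _.
by have := pD x (- x); rewrite subrr; lra.
Qed.

(** Covers two cases: slides, where the indices add up, and chains, where the smaller of two members
    is taken. *)
Lemma sublinear_inf {I : Type} (A : set I) (F : I -> V -> R) :
  A !=set0 -> (forall x, has_lbound [set F j x | j in A]) ->
  (forall j k x y, A j -> A k -> exists2 l, A l & F l (x + y) <= F j x + F k y) ->
  (forall s j x, 0 < s -> A j -> exists2 l, A l & F l (i s *: x) <= s * F j x) ->
  sublinear (fun x => inf [set F j x | j in A]).
Proof.
move=> [j0 Aj0] Flb FD FZ.
have infle x j : A j -> inf [set F j x | j in A] <= F j x.
  by move=> Aj; apply: ge_inf => //; exists j.
have leinf x b : (forall j, A j -> b <= F j x) -> b <= inf [set F j x | j in A].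
  by move=> h; apply: lb_le_inf; [exists (F j0 x), j0|move=> _ [j Aj <-]; exact: h].
split=> [x y|s x s0].
  rewrite -lerBlDr; apply: (leinf) => j Aj; rewrite lerBlDr -lerBlDl.
  apply: (leinf) => k Ak; rewrite lerBlDl.
  have [l Al lF] := FD j k x y Aj Ak; exact: le_trans (infle _ _ Al) lF.
rewrite -ler_pdivrMl//; apply: (leinf) => j Aj; rewrite ler_pdivrMl//.
have [l Al lF] := FZ s j x s0 Aj; exact: le_trans (infle _ _ Al) lF.
Qed.

(* Lowers [q] as much as possible in the direction [- y]. *)
Definition slide q y x := inf [set q (x + i t *: y) - t * q y | t in [set t | 0 <= t]].

(** Since t q(y) <= q(t y) <= q(- x) + q(x + t y), the infimum defining [slide] is finite. *)
Lemma slide_lb {q} : sublinear q -> forall y x t, 0 <= t ->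
  - q (- x) <= q (x + i t *: y) - t * q y.
Proof.
move=> sq y x t t0; have := sq.1 (- x) (x + i t *: y); rewrite addKr.
case: (ltrgtP 0 t) t0 => // [t0|<-] _; last first.
  rewrite rmorph0 scale0r addr0 mul0r; have := sublinear_ge_opp sq x; lra.
have := sq.2 t^-1 (i t *: y); rewrite invr_gt0 => /(_ t0).
rewrite scalerA -rmorphM mulVf ?gt_eqF// rmorph1 scale1r.
rewrite ler_pdivlMl//; lra.
Qed.

Lemma slide_le {q} : sublinear q -> forall y x t, 0 <= t ->
  slide q y x <= q (x + i t *: y) - t * q y.
Proof.
move=> sq y x t t0; apply: ge_inf; last by exists t.
by exists (- q (- x)) => _ [u /= u0 <-]; exact: slide_lb.
Qed.

Lemma sublinear_slide {q} y : sublinear q -> sublinear (slide q y).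
Proof.
move=> sq; apply: sublinear_inf; first by exists 0 => /=.
- by move=> x; exists (- q (- x)) => _ [u /= u0 <-]; exact: slide_lb.
- move=> t u x z /= t0 u0; exists (t + u); first exact: addr_ge0.
  rewrite rmorphD scalerDl addrACA mulrDl.
  by have := sq.1 (x + i t *: y) (z + i u *: y); lra.
- move=> s t x s0 /= t0; exists (s * t); first by rewrite mulr_ge0// ltW.
  rewrite rmorphM -scalerA -scalerDr mulrBr mulrA lerD2r.
  exact: sq.2.
Qed.

Lemma slide_id_le {q} y x : sublinear q -> slide q y x <= q x.
Proof.
move=> sq; apply: le_trans (slide_le sq y x 0 (lexx _)) _.
by rewrite rmorph0 scale0r addr0 mul0r subr0.
Qed.

Lemma minimal_sublinear p : sublinear p -> exists q, [/\ sublinear q,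
  forall x, q x <= p x &
  forall q', sublinear q' -> (forall x, q' x <= q x) -> q' = q].
Proof.
move=> sp; pose T := {q | sublinear q /\ forall x, q x <= p x}.
pose mk q sq qp : T := exist (fun q => sublinear q /\ forall x, q x <= p x) q (conj sq qp).
(* Larger for [Rl] means pointwise smaller, so a maximal element is a minimal functional. *)
pose Rl : rel T := fun s t => `[< forall x, sval t x <= sval s x >].
have [| | |A totA|[q [sq qp]] qm] := @Zorn T Rl.
- by move=> q; apply/asboolP.
- by move=> q r s /asboolP h /asboolP k; apply/asboolP => x; apply: le_trans (h x).
- move=> [q hq] [r hr] /asboolP h /asboolP k; apply: eq_exist => /=.
  by apply/funext => x; apply/eqP; rewrite eq_le h k.
- have [[q0 Aq0]|A0] := pselect (A !=set0); last first.
    exists (mk p sp (fun x => lexx _)) => s As.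
    by case: A0; exists s.
  (* Every sublinear q below p satisfies - p(- x) <= - q(- x) <= q x, a bound uniform along the
     chain. *)
  have lb x : has_lbound [set sval q x | q in A].
    exists (- p (- x)) => _ [[q [sq qp]] _ <-] /=.
    by apply: le_trans (sublinear_ge_opp sq x); rewrite lerN2.
  have sI : sublinear (fun x => inf [set sval q x | q in A]).
    apply: sublinear_inf => //; first by exists q0.
      move=> q r x y Aq Ar; have [/asboolP h|/asboolP h] := totA q r Aq Ar.
        exists r => //; apply: le_trans ((svalP r).1.1 _ _) _.
        by rewrite lerD2r.
      exists q => //; apply: le_trans ((svalP q).1.1 _ _) _.
      by rewrite lerD2l.
    by move=> s q x s0 Aq; exists q => //; exact: (svalP q).1.2.
  have Ip x : inf [set sval q x | q in A] <= p x.
    apply: le_trans ((svalP q0).2 x); apply: ge_inf => //; by exists q0.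
  exists (mk _ sI Ip) => s As; apply/asboolP => x /=.
  by apply: ge_inf => //; exists s.
- exists q; split=> // q' sq' qq'.
  have q'p x : q' x <= p x by apply: le_trans (qq' x) (qp x).
  have := qm (mk q' sq' q'p).
  by move=> /(_ (asboolT _)) h; have [] := h qq'.
Qed.

Lemma hahn_banach p x0 : sublinear p -> exists f : V -> R, [/\
  forall x y, f (x + y) = f x + f y, forall s x, f (i s *: x) = s * f x,
  forall x, f x <= p x & f x0 = p x0].
Proof.
(* Sliding along x0 forces q (- x0) = - p x0; a minimal q is unchanged by
   sliding along y, which makes it superadditive. *)
move=> sp; have [q [sq qs qmin]] := minimal_sublinear _ (sublinear_slide x0 sp).
have qp x : q x <= p x by apply: le_trans (qs x) (slide_id_le _ _ sp).
have qD x y : q (x + y) = q x + q y.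
  apply/eqP; rewrite eq_le sq.1 /=.
  have := slide_le sq y x 1 ler01; rewrite (qmin _ (sublinear_slide y sq)).
    by rewrite rmorph1 scale1r mul1r; lra.
  by move=> z; exact: slide_id_le.
have q0 : q 0 = 0 by have := qD 0 0; rewrite addr0; lra.
have qN x : q (- x) = - q x by have := qD x (- x); rewrite subrr q0; lra.
have qZ s x : 0 < s -> q (i s *: x) = s * q x.
  move=> s0; apply/eqP; rewrite eq_le sq.2//=.
  have := sq.2 s^-1 (i s *: x); rewrite invr_gt0 => /(_ s0).
  rewrite scalerA -rmorphM mulVf ?gt_eqF// rmorph1 scale1r.
  by rewrite ler_pdivlMl.
exists q; split=> // [s x|].
  have [s0|s0|<-] := ltrgtP 0 s; first exact: qZ.
    have := qZ (- s) x; rewrite oppr_gt0 => /(_ s0).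
    by rewrite rmorphN scaleNr qN mulNr => /oppr_inj.
  by rewrite rmorph0 scale0r mul0r.
apply/eqP; rewrite eq_le qp/= -lerN2 -qN (le_trans (qs _))//.
have := slide_le sp x0 (- x0) 1 ler01; rewrite rmorph1 scale1r addNr mul1r.
(* Homogeneity with s = 1/2 gives p 0 <= p 0 / 2. *)
have : p 0 <= 0; last lra.
have /(_ ltac:(lra)) := sp.2 2^-1 0; rewrite scaler0; lra.
Qed.

End HahnBanach.

(** * Non-vanishing bounded functionals and Dedekind-infiniteness *)

Definition bounded_functional {K : numFieldType} {E : normedModType K} (phi : E -> K) :=
  (forall a x y, phi (a *: x + y) = a * phi x + phi y) /\
  exists M : K, forall x, `|phi x| <= M * `|x|.

Lemma real_functional {R : realType} (E : normedModType R) (x0 : E) : x0 != 0 ->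
  exists2 phi : E -> R, bounded_functional phi & phi x0 != 0.
Proof.
move=> x00; have sn : sublinear (@idfun R : {rmorphism R -> R}) (fun x : E => `|x|).
  split=> [x y|s x s0]; first exact: ler_normD.
  by rewrite normrZ gtr0_norm.
have [f [fD fZ fn fx0]] := hahn_banach _ _ x0 sn.
exists f; last by rewrite fx0 normr_eq0.
split=> [a x y|]; first by rewrite fD -fZ.
exists 1 => x; rewrite mul1r ler_norml fn andbT lerNl.
have <- : f (- x) = - f x by rewrite -scaleN1r [LHS](fZ (-1)) mulN1r.
by rewrite (le_trans (fn _))// normrN.
Qed.

Lemma complex_functional {R : realType} (E : normedModType R[i]) (x0 : E) : x0 != 0 ->
  exists2 phi : E -> R[i], bounded_functional phi & phi x0 != 0.
Proof.
move=> x00; pose p (x : E) : R := complex.Re `|x|.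
have pE x : (p x)%:C%C = `|x| by rewrite /p RRe_real ?normr_real.
have sn : sublinear (real_complex R : {rmorphism R -> R[i]}) p.
  split=> [x y|s x s0]; first by rewrite -lecR rmorphD /= !pE ler_normD.
  by rewrite -lecR rmorphM /= !pE normrZ gtr0_norm// ltcR.
have [f [fD fZ fp fx0]] := hahn_banach _ _ x0 sn.
have fN x : f (- x) = - f x.
  by rewrite -scaleN1r -(rmorphN1 (real_complex R)) [LHS](fZ (-1)) mulN1r.
have fn x : `|f x| <= p x.
  rewrite ler_norml fp andbT lerNl -fN (le_trans (fp _))//.
  by rewrite /p normrN.
(* A complex-linear functional is determined by its real part f, as f(x) - i f(i x). *)
pose phi x : R[i] := (f x +i* - f ('i%C *: x))%C.
have phiD x y : phi (x + y) = phi x + phi y.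
  by rewrite /phi scalerDr !fD opprD.
have phiZ (s : R) x : phi (s%:C%C *: x) = s%:C%C * phi x.
  rewrite /phi scalerA mulrC -scalerA !fZ.
  by apply/eqP; rewrite eq_complex /=; apply/andP; split; apply/eqP; ring.
have phii x : phi ('i%C *: x) = 'i%C * phi x.
  rewrite /phi scalerA; have -> : 'i%C * 'i%C = -1 :> R[i] by rewrite -expr2 sqr_i.
  rewrite scaleN1r fN opprK.
  by apply/eqP; rewrite eq_complex /=; apply/andP; split; apply/eqP; ring.
exists phi; last first.
  apply: contra_neq x00 => /(congr1 (@complex.Re R)) /= h.
  by apply/eqP; rewrite -normr_eq0 -pE -fx0 h.
split=> [a x y|].
  rewrite phiD {1}[a]complexE scalerDl -scalerA phiD phiZ phii phiZ.
  by rewrite mulrA -mulrDl -complexE.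
(* The modulus of phi x is at most |f(x)| + |f(i x)|, and both terms are at most the norm of x. *)
exists 2 => x; rewrite -pE -modulusE.
have -> : (2 : R[i]) = (2 : R)%:C%C by rewrite rmorph_nat.
rewrite -rmorphM lecR (le_trans (modulus_le_ReIm _))//= normrN.
have := fn x; have := fn ('i%C *: x).
have -> : p ('i%C *: x) = p x by rewrite /p normrZ normc_def /= expr0n expr1n add0r sqrtr1 mul1r.
lra.
Qed.

Section RankOne.
Context {K : numFieldType} {E : normedModType K}.

Lemma rank_one_subproof {phi : E -> K} (hphi : bounded_functional phi) (h : E) :
  (fun x => phi x *: h) \in bounded_linear (E := E).
Proof.
case: hphi => phiL [M phiM]; apply/asboolP; split=> [a x y|].
  by rewrite phiL scalerDl scalerA.
exists (M * `|h|) => x; rewrite normrZ mulrAC.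
by rewrite ler_wpM2r.
Qed.

Definition rank_one {phi : E -> K} (hphi : bounded_functional phi) (h : E) :=
  BoundedOp (rank_one_subproof hphi h).

End RankOne.

Lemma PFP_dedekind_infinite {K : numFieldType} (E : completeNormedModType K)
    (phi : E -> K) (x0 : E) : bounded_functional phi -> phi x0 != 0 ->
  infinite_dimensional E -> PFP E -> dedekind_infinite (boundedOp E).
Proof.
move=> hphi phix0 Einf EP; pose P := rank_one hphi ((phi x0)^-1 *: x0).
have [phiL _] := hphi.
have phiZ a x : phi (a *: x) = a * phi x.
  have phi0 : phi 0 = 0.
    by have := phiL (-1) 0 0; rewrite scaleN1r oppr0 addr0 mulN1r addNr.
  by have := phiL a x 0; rewrite phi0 !addr0.
have PP : P * P = P.
  apply: boundedOp_ext => x /=.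
  by rewrite !phiZ mulVf// mulr1.
have Px0 : P x0 = x0 by rewrite /= scalerA mulfV// scale1r.
have [[U [V UPV]]|[U [V UPV]]] := EP P.
  (* The range of P is a line, so U P V = 1 would make E the span of one vector. *)
  exfalso; apply: Einf; exists 1%N, (fun=> U ((phi x0)^-1 *: x0)) => x.
  exists (fun=> phi (V x)); rewrite big_ord1.
  have /(congr1 (fun T : boundedOp E => T x)) /= UPx := UPV; rewrite -{1}UPx.
  have := boundedOp_linear U (phi (V x)) ((phi x0)^-1 *: x0) 0.
  have U0 : U 0 = 0.
    by have := boundedOp_linear U (-1) 0 0; rewrite scaleN1r oppr0 addr0 scaleN1r addNr.
  by rewrite U0 !addr0.
exists (U * (1 - P)), ((1 - P) * V).
have QQ : (1 - P) * (1 - P) = 1 - P.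
  by rewrite mulrBl mul1r mulrBr mulr1 PP subrr subr0.
split; first by rewrite mulrA -(mulrA U) QQ.
have PQ : P * (1 - P) = 0 by rewrite mulrBr mulr1 PP subrr.
move=> /(congr1 (fun T => P * T)); rewrite !mulrA PQ !mul0r => P0.
have : x0 = 0 by rewrite -Px0 -[P]mulr1 -P0.
by move=> x00; move/eqP: phix0; apply; rewrite x00; have := phiZ 0 0; rewrite scaler0 mul0r.
Qed.

Lemma quotAlg_factor {K : numFieldType} (E : completeNormedModType K)
    (E0 : exists x : E, x != 0) (EP : PFP E) (a : quotAlg E0 EP) : a != 0 ->
  exists b c : quotAlg E0 EP, b * a * c = 1.
Proof.
move: a; apply: quotAlg_ind => T T0.
have [[U [V UTV]]|nT] := pselect (id_factors_through T); last first.
  case/negP: T0; apply/eqP/quotAlgP; rewrite subr0; exact/asboolP.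
exists (\pi_(quotAlg E0 EP)%qT U), (\pi_(quotAlg E0 EP)%qT V).
by have := congr1 (\pi_(quotAlg E0 EP)%qT) UTV; rewrite !Defs.pi_mul.
Qed.

Lemma infinite_dimensional_neq0 {K : numFieldType} (E : normedModType K) :
  infinite_dimensional E -> exists x : E, x != 0.
Proof.
move=> Einf; apply: contrapT => /forallNP E0; apply: Einf.
exists 0%N, (fun=> 0) => x; exists (fun=> 0); rewrite big_ord0.
by apply/eqP/negPn/negP/E0.
Qed.

(** * The ordinal interval [0, omega_1] *)

Section OmegaOne.
Local Open Scope classical_set_scope.
Local Notation W := omega1_itv.
Local Open Scope order_scope.
Implicit Types (a b x y z : W) (A D : set W).

Lemma le_w1 a : a <= None. Proof. by case: a. Qed.

(** Total, so that it can be the step of a well-founded recursion; the value on the empty set is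
    omega_1. *)
Definition least A : W := xget None [set a | A a /\ forall b, A b -> a <= b].

Lemma leastP A : A !=set0 -> A (least A) /\ forall b, A b -> least A <= b.
Proof.
move=> /omega1_itv_wf [a Aa am]; rewrite /least; case: xgetP => [b _ []//|].
by move=> /(_ a) []; split.
Qed.

Lemma omega1_itv_ind (P : W -> Prop) :
  (forall a, (forall b, b < a -> P b) -> P a) -> forall a, P a.
Proof.
move=> h; apply: contrapT => /existsNP nP.
have [na am] := @leastP [set a | ~ P a] nP; apply: na; apply: h => b ba.
by apply: contrapT => /am; rewrite leNgt ba.
Qed.

Lemma omega1_wf : well_founded (fun a b : W => a < b).
Proof. by move=> a; elim/omega1_itv_ind: a => a IH; constructor. Qed.

(** Otherwise each x < omega_1 lies below some element of A, and omega_1 would be a countable union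
    of countable initial segments. *)
Lemma countable_bounded A : countable A -> (forall a, A a -> a < None) ->
  exists2 b : W, b < None & forall a, A a -> a < b.
Proof.
move=> cA Alt; apply: contrapT => nb; apply: uncountable_below_None.
have : countable (\bigcup_(a in A) [set b | b <= a]).
  by apply: bigcup_countable => // a /Alt /countable_below.
apply: sub_countable; apply: subset_card_le => x /= xlt.
apply: contrapT => xA; apply: nb; exists x => // a Aa.
by rewrite ltNge; apply/negP => xa; apply: xA; exists a.
Qed.

Lemma seq_bounded (s : nat -> W) : (forall n, s n < None) ->
  exists2 b : W, b < None & forall n, s n < b.
Proof.
move=> sN; have [||b bN sb] := @countable_bounded (range s).
- exact: sub_countable (card_image_le _ _) (countableP _).
- by move=> _ [n _ <-].
- by exists b => // n; apply: sb; exists n.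
Qed.

Lemma seq_sup (s : nat -> W) : (forall n, s n < None) -> exists2 u : W, u < None &
  (forall n, s n <= u) /\ forall x, x < u -> exists n, x < s n.
Proof.
move=> sN; have [b bN sb] := seq_bounded s sN.
have [] := @leastP [set u | forall n, s n <= u]; first by exists b => n; exact: ltW.
set u := least _ => su um; exists u; last split=> // x xu.
  by apply: le_lt_trans bN; apply: um => n; exact: ltW.
apply: contrapT => /forallNP xs; have : u <= x.
  by apply: um => n; rewrite leNgt; apply/negP/xs.
by rewrite leNgt xu.
Qed.

(** Below omega_1 every point has a successor, so the half-open intervals ]y, x] form a base at x;
    at the least point the second condition is vacuous. *)
Lemma nbhs_omega1 x A : nbhs (x : order_topology W) A <->
  A x /\ forall y, y < x -> exists2 y, y < x & forall z, y < z -> z <= x -> A z.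
Proof.
rewrite order_nbhs_itv; split=> [[[l r] [lr]]|[Ax Al]].
  rewrite itv_boundlr => /andP[lx xr] iA; split.
    by apply: iA; rewrite /= itv_boundlr lx.
  move=> y yx.
  have zA z : (l <= BLeft z)%O -> z <= x -> A z.
    move=> lz zx; apply: iA; rewrite /= itv_boundlr lz /=.
    by apply: le_trans xr; rewrite bnd_simp.
  case: l lr lx zA {iA} => [[] c|[]] // lr lx zA.
  - by exists c; [rewrite bnd_simp in lx|move=> z cz; apply: zA; rewrite bnd_simp].
  - by exists y => // z _; apply: zA.
(* The open right end is the successor of x, or nothing when x is omega_1. *)
pose r := if x < None then BLeft (least [set z | x < z]) else +oo%O.
have xr : (BRight x <= r)%O.
  rewrite /r; case: ltP => // xN; rewrite bnd_simp.
  by have [] := @leastP [set z | x < z]; first by exists None.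
have ro : itv_open_ends (Interval -oo%O r) by rewrite /r; case: ifP.
have zr z : (BRight z <= r)%O -> z <= x.
  rewrite /r; case: ltP => [xN|Nx _]; last exact: le_trans (le_w1 z) Nx.
  rewrite bnd_simp => zl; rewrite leNgt; apply/negP => xz.
  have [|_ /(_ _ xz)] := @leastP [set z | x < z]; first by exists None.
  by rewrite leNgt zl.
have [[y yx]|ny] := pselect (exists y, y < x); last first.
  exists (Interval -oo%O r).
    by split=> //; rewrite itv_boundlr xr.
  move=> z /=; rewrite itv_boundlr /= => /zr.
  rewrite le_eqVlt => /orP[/eqP -> //|zx].
  by case: ny; exists z.
have {y yx} [y yx yA] := Al y yx.
exists (Interval (BRight y) r).
  split; last by rewrite itv_boundlr xr bnd_simp yx.
  by move: ro; rewrite /r; case: ifP => //; rewrite /itv_open_ends /= ?orbT.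
move=> z /=; rewrite itv_boundlr => /andP[]; rewrite bnd_simp => yz /zr.
exact: yA.
Qed.

(* A version of "closed and unbounded in omega_1" for subsets of [0, omega_1]
   that contain omega_1. *)
Definition club D := [/\ D None,
  forall x, x < None -> exists2 d, D d & x < d < None &
  forall u x, x < u -> (forall y, y < u -> exists2 d, D d & y < d <= u) -> D u].

(** * Enumeration of a club and its left adjoint *)

Section Enumeration.
Context D (clubD : club D).

Definition enum_step x (e : forall y, y < x -> W) : W :=
  least [set d | D d /\ forall y (yx : y < x), e y yx < d].

Definition enum_club : W -> W := Fix omega1_wf (fun _ => W) enum_step.

Lemma enum_clubE x :
  enum_club x = least [set d | D d /\ forall y, y < x -> enum_club y < d].
Proof.
rewrite /enum_club Fix_eq// => {}x f g fg; congr (enum_step _ _).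
by apply: functional_extensionality_dep => y; apply/funext => yx.
Qed.

Lemma enum_clubP x : [/\ D (enum_club x), forall y, y < x -> enum_club y < enum_club x,
  x < None -> enum_club x < None &
  forall d, D d -> (forall y, y < x -> enum_club y < d) -> enum_club x <= d].
Proof.
have [DN Dunb _] := clubD.
elim/omega1_itv_ind: x => x IH.
pose S := [set d | D d /\ forall y, y < x -> enum_club y < d].
(* Only countably many values precede stage x < omega_1, so they are bounded and D has an element
   below omega_1 beyond them. *)
have Sx : x < None -> exists2 d, S d & d < None.
  move=> xN; have [||b bN eb] := @countable_bounded (enum_club @` [set y | y < x]).
  - apply: sub_countable (card_image_le _ _) _.
    apply: sub_countable (subset_card_le _) (countable_below xN) => y /=; exact: ltW.
  - move=> _ [y /= yx <-]; have [_ _ + _] := IH y yx.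
    by apply; exact: lt_trans yx xN.
  have [d Dd /andP[bd dN]] := Dunb b bN; exists d => //; split=> // y yx.
  by apply: lt_trans bd; apply: eb; exists y.
have S0 : S !=set0.
  have [xN|Nx] := ltP x None; first by have [d Sd _] := Sx xN; exists d.
  exists None; split=> // y yx; have [_ _ + _] := IH y yx; apply.
  by apply: lt_le_trans yx (le_w1 x).
have [[De ey] em] := leastP _ S0; rewrite enum_clubE; split=> //.
  move=> /Sx [d Sd dN]; apply: le_lt_trans dN; exact: em.
by move=> d Dd dy; apply: em.
Qed.

Lemma lt_enum_club : {homo enum_club : x y / x < y}.
Proof. by move=> x y; have [_ + _ _] := enum_clubP y; apply. Qed.

Lemma le_enum_club : {mono enum_club : x y / x <= y}.
Proof. exact: le_mono lt_enum_club. Qed.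

Lemma enum_club_ge x : x <= enum_club x.
Proof.
elim/omega1_itv_ind: x => x IH; rewrite leNgt; apply/negP => ex.
by have := IH _ ex; rewrite leNgt lt_enum_club.
Qed.

Lemma enum_clubN : enum_club None = None.
Proof. by apply/eqP; rewrite eq_le le_w1 enum_club_ge. Qed.

(** Rounds x up to the next point of D and returns the index of that point. *)
Definition rank_club x := least [set y | x <= enum_club y].

Lemma rank_club_le x y : (rank_club x <= y) = (x <= enum_club y).
Proof.
have [xr rm] := @leastP [set y | x <= enum_club y] (ex_intro _ x (enum_club_ge x)).
apply/idP/idP => [|/rm//]; rewrite -le_enum_club; exact: le_trans.
Qed.

Lemma enum_clubK : cancel enum_club rank_club.
Proof.
move=> x; apply/eqP; rewrite eq_le rank_club_le lexx /= -le_enum_club.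
by rewrite -rank_club_le.
Qed.

Lemma rank_clubN : rank_club None = None.
Proof. by rewrite -{1}enum_clubN enum_clubK. Qed.

(** By the adjunction, ][enum_club] y, x] is mapped into ]y, [rank_club] x]; if the rank of x is the
    least point, the rank is constant on [0, x]. *)
Lemma rank_club_continuous :
  continuous (rank_club : order_topology W -> order_topology W).
Proof.
move=> x A /nbhs_omega1[/= Ar Al]; apply/nbhs_omega1; split=> // y0 y0x.
have rle z : z <= x -> rank_club z <= rank_club x.
  by move=> zx; rewrite rank_club_le (le_trans zx)// -rank_club_le.
have [[y yr]|nr] := pselect (exists y, y < rank_club x).
  have {y yr} [y yr yA] := Al y yr.
  exists (enum_club y); first by rewrite ltNge -rank_club_le -ltNge.
  move=> z yz zx; apply: yA; last exact: rle.
  by rewrite ltNge rank_club_le -ltNge.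
exists y0 => // z _ /rle; rewrite /preimage /= le_eqVlt => /orP[/eqP -> //|zx].
by case: nr; exists (rank_club z).
Qed.

(** Closedness of D rules out a gap between the value at a limit x and the earlier values. *)
Lemma enum_club_continuous :
  continuous (enum_club : order_topology W -> order_topology W).
Proof.
move=> x A /nbhs_omega1[/= Ae Al]; apply/nbhs_omega1; split=> // y0 y0x.
have [_ ltx _ mx] := enum_clubP x; have [_ _ closedD] := clubD.
have [y yx yA] := Al _ (ltx _ y0x).
have [[z [zx yz]]|nz] := pselect (exists z, z < x /\ y <= enum_club z).
  exists z => // t zt tx; apply: yA; last by rewrite le_enum_club.
  by apply: le_lt_trans yz (lt_enum_club _ _ zt).
have ey z : z < x -> enum_club z < y.
  by move=> zx; rewrite ltNge; apply/negP => yz; apply: nz; exists z.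
have [[w [wx wm]]|nw] := pselect (exists w, w < x /\ forall z, z < x -> z <= w).
  exists w => // z wz zx; have -> // : z = x.
  apply/eqP; rewrite eq_le zx /= leNgt; apply/negP => /wm.
  by rewrite leNgt wz.
(* Now x is a limit and all earlier values are below y < [enum_club] x. Their supremum u is in D,
   which forces [enum_club] x <= u <= y. *)
exfalso; pose u := least [set u | forall z, z < x -> enum_club z <= u].
have [] := @leastP [set u | forall z, z < x -> enum_club z <= u].
  by exists y => z /ey /ltW.
rewrite -/u => uub ulub.
have euu z : z < x -> enum_club z < u.
  move=> zx; have [t [tx zt]] : exists t, t < x /\ z < t.
    apply: contrapT => nt; apply: nw; exists z; split=> // t tx.
    by rewrite leNgt; apply/negP => zt; apply: nt; exists t.
  by apply: lt_le_trans (uub t tx); exact: lt_enum_club.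
have Du : D u.
  apply: (closedD u _ (euu y0 y0x)) => v vu.
  have [z [zx vz]] : exists z, z < x /\ v < enum_club z.
    apply: contrapT => nz'; have : u <= v.
      apply: ulub => z zx; rewrite leNgt; apply/negP => vz.
      by apply: nz'; exists z.
    by rewrite leNgt vu.
  exists (enum_club z); last by rewrite vz uub.
  by have [] := enum_clubP z.
have : enum_club x <= y.
  by apply: le_trans (mx u Du euu) (ulub y _) => z /ey /ltW.
by rewrite leNgt yx.
Qed.

End Enumeration.

(* The points below which [c] is closed; [c x > x] makes them limit points. *)
Definition closed_under (c : W -> W) : set W :=
  [set x | (exists y, y < x) /\ forall y, y < x -> c y < x].

Definition progressive (c : W -> W) := forall x, x < None -> x < c x < None.

Lemma exists_lt_w1 : exists y : W, y < None.
Proof.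
have [//|//|b bN _] := @countable_bounded set0.
by exists b.
Qed.

Lemma club_closed_under c : progressive c -> club (closed_under c).
Proof.
move=> pc; split.
- split; first exact: exists_lt_w1.
  by move=> y /pc /andP[].
- move=> x xN.
  (* The bound is uniform on [0, z], because c need not be monotone. *)
  have H z : exists t : W, z < None -> t < None /\ forall y, y <= z -> c y < t.
    have [zN|zN] := ltP z None; last by exists z; rewrite ltNge zN.
    have [||t tN ct] := @countable_bounded (c @` [set y | y <= z]).
    + exact: sub_countable (card_image_le _ _) (countable_below zN).
    + by move=> _ [y /= yz <-]; have /pc/andP[] := le_lt_trans yz zN.
    by exists t => _; split=> // y yz; apply: ct; exists y.
  have [h hP] := choice H.
  pose s n := iter n h x.
  have sN n : s n < None by elim: n => //= n IH; have [] := hP _ IH.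
  have sS n : s n < s n.+1.
    apply: lt_trans (_ : c (s n) < _); first by have /andP[] := pc _ (sN n).
    by have [_] := hP _ (sN n); apply.
  have [u uN [su us]] := seq_sup s sN.
  (* Any y < u lies below some s n, and then c y < s n.+1 <= u. *)
  exists u; last by rewrite uN (lt_le_trans (sS 0%N)) ?su.
  split; first by exists x; rewrite (lt_le_trans (sS 0%N)) ?su.
  move=> y /us [n yn]; apply: lt_le_trans (su n.+1).
  by have [_] := hP _ (sN n); apply; exact: ltW.
- move=> u x xu ud; split; first by exists x.
  move=> y yu; have [d [_ dc] /andP[yd du]] := ud y yu.
  by apply: lt_le_trans du; exact: dc.
Qed.

Lemma club_above D (d0 : W) : d0 < None -> club D -> club (D `&` [set x | d0 < x]).
Proof.
move=> d0N [DN Dunb Dcl]; split=> //.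
- move=> x xN; have mN : Order.max x d0 < None by rewrite gt_max xN.
  have [d Dd /andP[]] := Dunb _ mN; rewrite gt_max => /andP[xd dd] dN.
  by exists d; rewrite ?xd.
- move=> u x xu ud; split.
    by apply: (Dcl u x xu) => y yu; have [d [Dd _] yd] := ud y yu; exists d.
  have [d [_ /= d0d] /andP[_ du]] := ud x xu.
  exact: lt_le_trans d0d du.
Qed.

Lemma progressive_max c c' : progressive c -> progressive c' ->
  progressive (fun x => Order.max (c x) (c' x)).
Proof.
move=> pc pc' x xN; have /andP[xc cN] := pc x xN; have /andP[xc' cN'] := pc' x xN.
by rewrite lt_max xc gt_max cN.
Qed.

(** Intersections of clubs are handled through maxima of the functions that define them. *)
Lemma closed_under_max c c' :
  closed_under (fun x => Order.max (c x) (c' x)) = closed_under c `&` closed_under c'.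
Proof.
apply/seteqP; split=> x.
  move=> [ex cx]; split; split=> // y /cx; rewrite gt_max => /andP[] //.
move=> [[ex cx] [_ cx']]; split=> // y yx.
by rewrite gt_max cx// cx'.
Qed.

End OmegaOne.

(** * Operators on C[0, omega_1] *)

Section ContinuousOmegaOne.
Local Open Scope classical_set_scope.
Context {R : realType}.
Local Notation W := omega1_itv.
Local Notation X := (order_topology W).
Local Notation C := (C_omega1 R).
Local Notation w1 := (None : W).
Implicit Types (x y z b : W) (f g : C) (T : boundedOp C) (e M : R).

Lemma modulus_le_eps (z : R[i]) : (forall e, 0 < e -> modulus z <= e) -> z = 0.
Proof.
move=> h; apply: modulus_eq0; apply/eqP; rewrite eq_le modulus_ge0 andbT.
by apply/ler_addgt0Pr => e e0; rewrite add0r h.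
Qed.

Lemma C_near f x y e : 0 < e -> (y < x)%O -> exists2 y : W, (y < x)%O &
  forall z, (y < z)%O -> (z <= x)%O -> modulus (f x - f z) < e.
Proof.
move=> e0 yx; have fx : nbhs (x : X) [set z | `|f x - f z| < e%:C%C].
  by have /cvgrPdist_lt := @C_omega1_continuous R f x; apply; rewrite ltcR.
have [_ /(_ _ yx) [t tx tf]] := (nbhs_omega1 _ _).1 fx.
by exists t => // z tz zx; have := tf z tz zx; rewrite /= -modulusE ltcR.
Qed.

(** If the oscillation of v stayed above 1/(k+1), iteration would build an increasing sequence with
    all jumps above it. The thresholds found for the different k are countably many, hence have a
    common bound. *)
Lemma eventually_constant (v : W -> R[i]) :
  (forall e (s : nat -> W), 0 < e -> (forall n, (s n < w1)%O) ->
    (forall n, (s n < s n.+1)%O) ->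
    exists n, modulus (v (s n.+1) - v (s n)) <= e) ->
  exists2 b, (b < w1)%O & forall x, (b <= x)%O -> (x < w1)%O -> v x = v b.
Proof.
move=> vs.
have H (k : nat) : exists b, (b < w1)%O /\
    forall x, (b <= x)%O -> (x < w1)%O -> modulus (v x - v b) <= k.+1%:R^-1.
  apply: contrapT => /forallNP nb.
  have nb' b : exists x, (b < w1)%O ->
      [/\ (b < x)%O, (x < w1)%O & ~ modulus (v x - v b) <= k.+1%:R^-1].
    have [bN|Nb] := boolP (b < w1)%O; last by exists b.
    have /not_andP[//|/existsNP[x]] := nb b.
    move=> /not_implyP[bx /not_implyP[xN h]]; exists x => _; split=> //.
    rewrite lt_neqAle bx andbT; apply/eqP => bE; apply: h.
    by rewrite bE subrr modulus0 invr_ge0.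
  have [h hP] := choice nb'; have [b0 b0N] := exists_lt_w1.
  pose s n := iter n h b0.
  have sN n : (s n < w1)%O by elim: n => //= n IH; have [] := hP _ IH.
  have [|||n] := vs k.+1%:R^-1 s => // [n|]; first by have [] := hP _ (sN n).
  by have [_ _] := hP _ (sN n).
have [b bP] := choice H.
have [|t tN bt] := seq_bounded b; first by move=> k; have [] := bP k.
exists t => // x tx xN; apply/eqP; rewrite -subr_eq0; apply/eqP.
apply: modulus_le_eps => e e0.
have [k ke] : exists k : nat, k.+1%:R^-1 <= e / 2.
  have [k _ /(_ k (leqnn k)) /= ke] := near_infty_natSinv_lt (PosNum (divr_gt0 e0 (ltr0Sn R 1))).
  by exists k; apply: ltW.
have [bN bk] := bP k.
have h1 := le_trans (bk x (le_trans (ltW (bt k)) tx) xN) ke.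
have h2 := le_trans (bk t (ltW (bt k)) tN) ke.
have -> : v x - v t = (v x - v (b k)) - (v t - v (b k)) by rewrite opprB addrA subrK.
apply: le_trans (ler_modulusD _ _) _; rewrite modulusN; lra.
Qed.

(** The values f (s n) converge to the value of f at the supremum of s. *)
Lemma C_increasing_seq f e (s : nat -> W) : 0 < e -> (forall n, (s n < w1)%O) ->
  (forall n, (s n < s n.+1)%O) -> exists n, modulus (f (s n.+1) - f (s n)) <= e.
Proof.
move=> e0 sN sS; have [u uN [su us]] := seq_sup s sN.
have e20 : 0 < e / 2 by rewrite divr_gt0.
have [y yu yf] := C_near f u (s 0%N) (e / 2) e20 (lt_le_trans (sS 0%N) (su 1%N)).
have [n yn] := us _ yu; exists n.
have h1 := yf _ yn (su n); have h2 := yf _ (lt_trans yn (sS n)) (su n.+1).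
have -> : f (s n.+1) - f (s n) = (f u - f (s n)) - (f u - f (s n.+1)).
  by rewrite opprB [RHS]addrC subrKA.
apply: le_trans (ler_modulusD _ _) _; rewrite modulusN; lra.
Qed.

Lemma C_eventually_constant f : exists2 b, (b < w1)%O &
  forall x, (b <= x)%O -> f x = f w1.
Proof.
have [|b bN fb] := eventually_constant f; first exact: C_increasing_seq.
suff fbN : f b = f w1.
  by exists b => // x bx; have [/fb -> //|Nx] := ltP x w1; case: x bx Nx.
apply/esym/eqP; rewrite -subr_eq0; apply/eqP.
apply: modulus_le_eps => e e0; have [y yN yf] := C_near f w1 b e e0 bN.
have [|t tN ht] := seq_bounded (fun=> Order.max b y); first by move=> _; rewrite gt_max bN.
have := ht 0%N; rewrite gt_max => /andP[bt yt].
by rewrite -(fb t (ltW bt) tN) ltW// yf// le_w1.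
Qed.

(** * Step functions and functionals bounded for the supremum norm *)

Lemma step_subproof b :
  (fun x : X => (x <= b)%O%:R : R[i]^o) \in continuous_pred (V := R[i]^o).
Proof.
apply/asboolP => x; apply/(@cvgrPdist_lt _ _ _ (nbhs (x : X))) => _ /complex_gt0E[e e0 ->].
apply/nbhs_omega1; split; first by rewrite /= subrr normr0 ltcR.
(* [0, b] is clopen: the step is 1 on [0, x] if x <= b, and 0 on ]b, x] otherwise. *)
move=> y yx; have [xb|bx] := leP x b.
  exists y => // z yz zx /=; rewrite (le_trans zx xb) subrr normr0 ltcR//.
exists b => // z bz zx /=; rewrite leNgt bz /= subrr normr0 ltcR//.
Qed.

Definition step b : C := MkC_omega1 (step_subproof b).

Lemma stepE b x : step b x = (x <= b)%O%:R. Proof. by []. Qed.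

(** The bound is stated with pointwise moduli to keep the estimates in R, the norm of C[0, omega_1]
    being [R[i]]-valued. *)
Definition sup_bounded (theta : C -> R[i]) :=
  (forall a f g, theta (a *: f + g) = a * theta f + theta g) /\
  exists M, forall f c, (forall x, modulus (f x) <= c) -> modulus (theta f) <= M * c.

Lemma sup_boundedP theta : sup_bounded theta -> [/\ theta 0 = 0,
  forall f g, theta (f + g) = theta f + theta g,
  forall f g, theta (f - g) = theta f - theta g &
  forall a f, theta (a *: f) = a * theta f].
Proof.
move=> [thL _]; have th0 : theta 0 = 0.
  by have := thL (-1) 0 0; rewrite scaleN1r oppr0 addr0 mulN1r addNr.
split=> // [f g|f g|a f].
- by have := thL 1 f g; rewrite scale1r mul1r.
- by have := thL (-1) g f; rewrite scaleN1r mulN1r [- g + f]addrC [- _ + _]addrC.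
- by have := thL a f 0; rewrite th0 !addr0.
Qed.

Lemma sup_bounded_lin a theta theta' : sup_bounded theta -> sup_bounded theta' ->
  sup_bounded (fun f => a * theta f + theta' f).
Proof.
move=> [thL [M thM]] [thL' [M' thM']]; split=> [k f g|].
  by rewrite thL thL'; ring.
exists (modulus a * M + M') => f c fc.
rewrite (le_trans (ler_modulusD _ _))// mulrDl lerD//; last exact: thM'.
by rewrite modulusM -mulrA ler_wpM2l ?modulus_ge0// thM.
Qed.

Lemma sup_bounded_op T x : sup_bounded (fun f => T f x).
Proof.
split=> [a f g|]; first by rewrite boundedOp_linear.
have [M M0 TM] := boundedOp_bounded T.
have [m mE] : exists m : R, M = m%:C%C.
  by exists (complex.Re M); rewrite RRe_real ?ger0_real.
exists m => f c fc; apply: le_trans (modulus_le_supnorm (T f) x) _.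
have := TM f; rewrite !C_omega1_normE mE -rmorphM lecR => /le_trans; apply.
by rewrite ler_wpM2l ?supnorm_le//; rewrite -ler0c -mE.
Qed.

(** Infinitely many jumps larger than e would give functions of norm at most 1, supported on
    disjoint intervals, on which theta is at least n e for every n. *)
Lemma step_eventually theta : sup_bounded theta ->
  exists2 b, (b < w1)%O &
    forall x, (b <= x)%O -> (x < w1)%O -> theta (step x) = theta (step b).
Proof.
move=> sth; have [th0 thD thB thZ] := sup_boundedP _ sth.
apply: eventually_constant => e s e0 sN sS; apply: contrapT => /forallNP ns.
have [_ [M thM]] := sth.
have H n : exists f, [/\ forall x, modulus (f x) <= 1,
    forall x, (s n < x)%O -> f x = 0 &
    exists2 r : R, theta f = r%:C%C & n%:R * e <= r].
  elim: n => [|n [f [f1 f0 [r fr rn]]]].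
    exists 0; split=> [x|//|]; first by rewrite [modulus _]modulus0.
    by exists 0; rewrite ?th0 ?mul0r.
  (* The phases c align the jumps of theta, on disjoint intervals. *)
  pose d := theta (step (s n.+1)) - theta (step (s n)).
  have de : e < modulus d by rewrite ltNge; apply/negP/ns.
  have d0 : d != 0.
    by apply: contraTneq de => ->; rewrite modulus0 -leNgt ltW.
  pose c : R[i] := (modulus d)%:C%C / d.
  have c1 : modulus c = 1.
    apply: complexI; rewrite modulusE /c normrM normfV modulusE normr_id.
    by rewrite mulfV ?normr_eq0.
  exists (c *: (step (s n.+1) - step (s n)) + f); split=> [x|x snx|].
  - have -> : (c *: (step (s n.+1) - step (s n)) + f) x =
        c * ((x <= s n.+1)%O%:R - (x <= s n)%O%:R) + f x by [].
    have [xn|nx] := leP x (s n).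
      by rewrite (le_trans xn (ltW (sS n))) subrr mulr0 add0r.
    rewrite f0// addr0 subr0 modulusM c1 mul1r.
    case: (x <= s n.+1)%O; last by rewrite modulus0.
    by rewrite /modulus normr1.
  - have -> : (c *: (step (s n.+1) - step (s n)) + f) x =
        c * ((x <= s n.+1)%O%:R - (x <= s n)%O%:R) + f x by [].
    have snx' := lt_trans (sS n) snx.
    by rewrite f0// !leNgt snx snx' subrr mulr0 addr0.
  - exists (modulus d + r); last by rewrite -natr1 mulrDl mul1r addrC lerD// ltW.
    by rewrite thD thZ thB -/d fr rmorphD /= /c mulfVK.
have /archi_boundP : 0 <= `|M| / e by rewrite divr_ge0// ltW.
set n := Num.bound _; rewrite ltr_pdivrMr// => Mn.
have [f [f1 _ [r fr nr]]] := H n.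
have := thM f 1 f1; rewrite fr mulr1 => rM.
have := Re_le_modulus r%:C%C => /= rr.
have := ler_norm r; have := ler_norm M; lra.
Qed.

(** Transfinite induction on x approximates f on [0, x]: by continuity f is nearly f x on some ]y,
    x], and f x times the indicator of ]y, x] is added to the approximant for y. Membership in the
    span of the steps is recorded only as [theta g = 0]. *)
Lemma step_span theta : sup_bounded theta -> (forall b, theta (step b) = 0) ->
  forall f, theta f = 0.
Proof.
move=> sth thstep f; have [th0 thD thB thZ] := sup_boundedP _ sth.
have H e x : 0 < e -> exists g, [/\ theta g = 0,
    forall y, (y <= x)%O -> modulus (f y - g y) <= e &
    forall y, (x < y)%O -> g y = 0].
  move=> e0; elim/omega1_itv_ind: x => x IH.
  have [[y yx]|nx] := pselect (exists y, (y < x)%O); last first.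
    exists (f x *: step x); split.
    - by rewrite thZ thstep mulr0.
    - move=> y yx; have -> : y = x.
        by apply/eqP; rewrite eq_le yx leNgt; apply/negP => xy; apply: nx; exists y.
      have -> : (f x *: step x) x = f x * (x <= x)%O%:R by [].
      by rewrite lexx mulr1 subrr modulus0 ltW.
    - move=> y xy; have -> : (f x *: step x) y = f x * (y <= x)%O%:R by [].
      by rewrite leNgt xy mulr0.
  have {y yx}[y yx fy] := C_near f x y e e0 yx.
  have [g [thg gy g0]] := IH y yx.
  exists (f x *: (step x - step y) + g); split.
  - by rewrite thD thZ thB !thstep subrr mulr0 add0r.
  - move=> z zx; have -> : (f x *: (step x - step y) + g) z =
        f x * ((z <= x)%O%:R - (z <= y)%O%:R) + g z by [].
    rewrite zx; have [zy|yz] := leP z y; first by rewrite subrr mulr0 add0r gy.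
    by rewrite subr0 mulr1 g0// addr0 modulus_distC ltW// fy.
  - move=> z xz; have -> : (f x *: (step x - step y) + g) z =
        f x * ((z <= x)%O%:R - (z <= y)%O%:R) + g z by [].
    by rewrite !leNgt xz (lt_trans yx xz) subrr mulr0 add0r g0// (lt_trans yx).
have [_ [M thM]] := sth.
apply: modulus_le_eps => e e0.
(* M may be zero or negative, hence the denominator. *)
have d0 : 0 < e / (`|M| + 1) by rewrite divr_gt0// ltr_pwDr.
have [g [thg fg _]] := H _ w1 d0.
rewrite -[theta f]subr0 -thg -thB.
apply: le_trans (thM (f - g) _ (fun x => fg x (le_w1 x))) _.
rewrite mulrA ler_pdivrMr ?ltr_pwDr// mulrC ler_wpM2l ?ltW//.
by have := ler_norm M; lra.
Qed.
End ContinuousOmegaOne.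

(** * Eigenvalues along clubs and the consequences for operators *)

Section OperatorsOmegaOne.
Local Open Scope classical_set_scope.
Context {R : realType}.
Local Notation W := omega1_itv.
Local Notation X := (order_topology W).
Local Notation C := (C_omega1 R).
Local Notation w1 := (None : W).
Implicit Types (x y z b : W) (f g : C) (T : boundedOp C) (e M : R).

Lemma sup_bounded_jump T x : sup_bounded (fun f => T f w1 - T f x).
Proof.
have -> : (fun f => T f w1 - T f x) = (fun f => -1 * T f x + T f w1).
  by apply/funext => f; rewrite mulN1r addrC.
by apply: sup_bounded_lin; exact: sup_bounded_op.
Qed.

Lemma jump_eigenvector T : exists (lambda : R[i]) (c : W -> W), progressive c /\
  forall x, closed_under c x -> forall f, T f w1 - T f x = lambda * (f w1 - f x).
Proof.
pose k x b := T (step b) w1 - T (step b) x.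
have /choice[p pP] b : exists t, (t < w1)%O /\
    forall x, (t <= x)%O -> T (step b) x = T (step b) w1.
  by have [t] := C_eventually_constant (T (step b)); exists t.
have /choice[q qP] x : exists t, (t < w1)%O /\
    forall b, (t <= b)%O -> (b < w1)%O -> k x b = k x t.
  by have [t] := step_eventually _ (sup_bounded_jump T x); exists t.
(* [k x (q x)] is the eventual value of [k x]. Along a sequence s, one b beyond all q (s n) computes
   these values from the single continuous function T (step b). *)
have [|b0 b0N lb] := eventually_constant (fun x => k x (q x)).
  move=> e s e0 sN sS.
  have [b bN qb] := seq_bounded (fun n => q (s n)) (fun n => (qP (s n)).1).
  have [n hn] := C_increasing_seq (T (step b)) e s e0 sN sS; exists n.
  rewrite -!((qP _).2 b (ltW (qb _)) bN) /k opprB addrC subrKA.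
  by rewrite modulus_distC.
pose l := k b0 (q b0).
(* Points closed under c lie beyond b0 and p w1 and are closed under p and q. *)
have H z : exists t, (z < w1)%O -> [/\ (z < t < w1)%O, (p z < t)%O, (q z < t)%O,
    (b0 < t)%O & (p w1 < t)%O].
  have [zN|Nz] := boolP (z < w1)%O; last by exists w1.
  have [|t tN ht] := seq_bounded
      (fun=> Order.max (Order.max (Order.max (Order.max z (p z)) (q z)) b0) (p w1)).
    by move=> _; rewrite !gt_max zN b0N (pP z).1 (pP w1).1 (qP z).1.
  exists t => _; have := ht 0%N; rewrite !gt_max tN.
  by do 4![case/andP]; move=> *; split=> //; apply/andP.
have [c cP] := choice H.
(* The sign is due to the jump of [step b] at x, which is - 1 for x <= b < omega_1. *)
exists (- l), c; split=> [z /cP[]//|x [[y yx] cx] f].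
have [->|xN] := eqVneq x w1; first by rewrite !subrr mulr0.
have {}xN : (x < w1)%O by rewrite lt_neqAle xN le_w1.
have cy z : (z < x)%O -> [/\ (z < c z)%O, (p z < x)%O, (q z < x)%O, (b0 < c z)%O & (p w1 < x)%O].
  move=> zx; have [/andP[zc _] h1 h2 h3 h4] := cP z (lt_trans zx xN).
  by split=> //; apply: lt_trans (cx z zx).
pose theta f := l * (f w1 - f x) + (T f w1 - T f x).
have sth : sup_bounded theta.
  apply: sup_bounded_lin; last exact: sup_bounded_jump.
  exact: (sup_bounded_jump (1 : boundedOp C)).
suff th0 : forall b, theta (step b) = 0.
  have := step_span theta sth th0 f; rewrite /theta mulNr => /eqP.
  by rewrite addrC addr_eq0 => /eqP.
move=> b; rewrite /theta !stepE.
have [bx|xb] := ltP b x.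
  have [_ pb _ _ _] := cy b bx.
  rewrite (pP b).2 ?(ltW pb)// subrr addr0.
  rewrite [(w1 <= b)%O]leNgt (lt_trans bx xN).
  by rewrite subrr mulr0.
(* For b = omega_1 the step is the constant 1, and x lies beyond p w1, so both jumps vanish. *)
have [bN|Nb] := ltP b w1; last first.
  have -> : b = w1 by apply/eqP; rewrite eq_le Nb le_w1.
  have [_ _ _ _ pw] := cy y yx.
  by rewrite (pP w1).2 ?(ltW pw)// !subrr mulr0 addr0.
(* The jump of T (step b) is exactly l at the points c z < x, because q (c z) < x <= b; continuity
   at the limit x carries this over to x. *)
rewrite sub0r mulrN1 addrC; apply: modulus_le_eps => e e0.
have [z zx Tz] := C_near (T (step b)) x y e e0 yx.
have [zc _ _ b0c _] := cy z zx; have czx := cx z zx.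
have [_ _ qc _ _] := cy (c z) czx.
have -> : l = k (c z) b.
  by rewrite (qP (c z)).2// ?(le_trans (ltW qc))// lb ?(ltW b0c)// (lt_trans czx).
rewrite /k opprB addrC subrKA modulus_distC.
exact/ltW/Tz/ltW.
Qed.

Lemma closed_under_nonempty c : progressive c ->
  exists2 x, closed_under c x & (x < w1)%O.
Proof.
move=> pc; have [_ unb _] := club_closed_under c pc.
have [b bN] := exists_lt_w1; have [x cx /andP[_ xN]] := unb b bN.
by exists x.
Qed.

(** At one x common to the four clubs eigenvalues multiply: t s = 1 = u v makes the eigenvalue of s
    t v u equal to 1, while this product is p q = 0. *)
Lemma not_properly_infinite : ~ properly_infinite (boundedOp C).
Proof.
move=> [p [q [_ _ pq0 _ [[s [t [pst tsI]]] [u [v [uvI qvu]]]]]]].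
have [ls [cs [pcs hs]]] := jump_eigenvector s.
have [lt [ct [pct ht]]] := jump_eigenvector t.
have [lu [cu [pcu hu]]] := jump_eigenvector u.
have [lv [cv [pcv hv]]] := jump_eigenvector v.
have pc := progressive_max _ _ (progressive_max _ _ pcs pct)
                                (progressive_max _ _ pcu pcv).
have [x] := closed_under_nonempty _ pc.
rewrite !closed_under_max => -[[/hs{}hs /ht{}ht] [/hu{}hu /hv{}hv]] xN.
pose f : C := step x.
have jf : f w1 - f x = -1 by rewrite !stepE lexx leNgt xN sub0r.
have ts1 : lt * ls = 1.
  have := congr1 (fun T : boundedOp C => T f w1 - T f x) tsI.
  by rewrite /= ht hs jf mulrA mulrN1 => /oppr_inj.
have uv1 : lu * lv = 1.
  have := congr1 (fun T : boundedOp C => T f w1 - T f x) uvI.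
  by rewrite /= hu hv jf mulrA mulrN1 => /oppr_inj.
move: pq0; rewrite pst qvu => /(congr1 (fun T : boundedOp C => T f w1 - T f x)).
rewrite /= hs ht hv hu jf => /eqP; rewrite subrr.
have -> : ls * (lt * (lv * (lu * -1))) = - ((lt * ls) * (lu * lv)) by ring.
by rewrite ts1 uv1 mulr1 oppr_eq0 oner_eq0.
Qed.

(** If n functions spanned, a non-zero combination w of evaluations at n + 1 points would kill every
    function; testing it on the steps at these points gives a triangular system whose only solution
    is 0. *)
Lemma infinite_dimensional_C_omega1 : infinite_dimensional C.
Proof.
move=> [n [e espan]].
have H z : exists t, (z < w1)%O -> (z < t < w1)%O.
  have [zN|Nz] := boolP (z < w1)%O; last by exists w1.
  have [//|t tN /(_ 0%N) zt] := seq_bounded (fun=> z).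
  by exists t; rewrite zt tN.
have [h hP] := choice H; have [y0 y0N] := exists_lt_w1.
pose s k := iter k h y0.
have sN k : (s k < w1)%O by elim: k => //= k /hP /andP[].
have sS k : (s k < s k.+1)%O by have /andP[] := hP _ (sN k).
have slt : {homo s : i j / (i < j)%N >-> (i < j)%O}.
  by apply: homo_ltn sS => x y z; exact: lt_trans.
have sle i j : (s i <= s j)%O = (i <= j)%N.
  have [ij|ji] := leqP i j; last by rewrite leNgt slt.
  by move: ij; rewrite leq_eqVlt => /orP[/eqP ->|/slt/ltW //]; rewrite lexx.
pose A : 'M[R[i]]_(n.+1, n) := \matrix_(j, i) e i (s j).
have /rowV0Pn[w wA w0] : kermx A != 0.
  by rewrite kermx_eq0 /row_free neq_ltn ltnS rank_leq_col.
have wf f : \sum_j w 0 j * f (s j) = 0.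
  have [c fc] := espan f.
  have fE x : f x = \sum_i c i * e i x.
    by rewrite fc; elim/big_rec2: _ => // i _ g _ <-.
  under eq_bigr do rewrite fE mulr_sumr.
  rewrite exchange_big big1// => i _.
  have /sub_kermxP/matrixP/(_ 0 i) := wA; rewrite !mxE => wAi.
  transitivity (c i * \sum_j w 0 j * A j i); last by rewrite wAi mulr0.
  rewrite mulr_sumr; apply: eq_bigr => j _.
  by rewrite mxE mulrCA.
have wS j : \sum_(i < n.+1 | (i <= j)%N) w 0 i = 0.
  rewrite -[RHS](wf (step (s j))) [LHS]big_mkcond; apply: eq_bigr => i _.
  by rewrite stepE sle; case: ifP; rewrite ?mulr1 ?mulr0.
case/negP: w0; apply/eqP/rowP => j; rewrite mxE.
have [m] := ubnP (val j); elim: m j => // m IH j; rewrite ltnS => jm.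
have := wS j; rewrite (bigD1 j)//= big1 ?addr0// => i /andP[ij ne].
by apply: IH; apply: leq_trans jm; rewrite ltn_neqAle ij andbT.
Qed.

(** * Factoring the identity through an operator with non-zero eigenvalue *)

Lemma comp_subproof {rho : X -> X} (crho : continuous rho) f :
  (f \o rho) \in continuous_pred (V := R[i]^o).
Proof.
apply/asboolP => x; apply: continuous_comp; [exact: crho|].
exact: C_omega1_continuous.
Qed.

Lemma composition_subproof {rho : X -> X} (crho : continuous rho) :
  (fun f => MkC_omega1 (comp_subproof crho f)) \in bounded_linear (E := C).
Proof.
apply/asboolP; split=> [a f g|]; first exact: val_inj.
exists 1 => f; rewrite mul1r !C_omega1_normE lecR; apply: supnorm_le => x.
exact: (modulus_le_supnorm f (rho x)).
Qed.

Definition composition {rho : X -> X} (crho : continuous rho) :=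
  BoundedOp (composition_subproof crho).

Lemma bounded_functional_eval x : bounded_functional (fun f : C => f x).
Proof.
split=> //; exists 1 => f; rewrite mul1r C_omega1_normE -modulusE lecR.
exact: modulus_le_supnorm.
Qed.

Lemma factor_of_eigenvalue T (lambda : R[i]) (c : W -> W) : progressive c ->
  (forall x, closed_under c x ->
    forall f, T f w1 - T f x = lambda * (f w1 - f x)) ->
  lambda != 0 -> id_factors_through T.
Proof.
move=> pc hT l0; have [d0 cd0 d0N] := closed_under_nonempty c pc.
have cD := club_above _ d0 d0N (club_closed_under c pc).
pose D := closed_under c `&` [set x | (d0 < x)%O].
pose delta := enum_club D; pose r := rank_club D.
pose ev x h := rank_one (bounded_functional_eval x) h.
(* V f is 0 at omega_1, f x - f(omega_1) at delta x, and f(omega_1) at the spare point d0; the last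
   term, supported on [0, d0], corrects the value there. *)
pose V := composition (rank_club_continuous _ cD) - ev w1 (step w1)
          + (2 *: ev w1 (step d0) - ev (r d0) (step d0)).
(* U subtracts the jumps at d0 and delta x. T scales both by lambda, so U T V f x is f(omega_1) + (f
   x - f(omega_1)). *)
pose U := lambda^-1 *: (composition (enum_club_continuous _ cD)
          + ev d0 (step w1) - 2 *: ev w1 (step w1)).
have VE f x : V f x = f (r x) - f w1 + (2 * f w1 - f (r d0)) * (x <= d0)%O%:R.
  have -> : V f x = f (r x) - f w1 * (x <= w1)%O%:R
    + (2 * (f w1 * (x <= d0)%O%:R) - f (r d0) * (x <= d0)%O%:R) by [].
  by rewrite le_w1 mulr1; ring.
have UE g x : U g x = lambda^-1 * (g (delta x) + g d0 - 2 * g w1).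
  have -> : U g x = lambda^-1 * (g (delta x) + g d0 * (x <= w1)%O%:R
                                 - 2 * (g w1 * (x <= w1)%O%:R)) by [].
  by rewrite le_w1 !mulr1.
have cdelta x : closed_under c (delta x) /\ (d0 < delta x)%O.
  by have [] := enum_clubP _ cD x.
exists U, V; apply: boundedOp_ext => f; apply/val_inj/funext => x.
have -> : val ((U * T * V) f) x = U (T (V f)) x by [].
have [cdx d0x] := cdelta x; have h1 := hT _ cd0 (V f); have h2 := hT _ cdx (V f).
rewrite UE.
have -> : T (V f) (delta x) + T (V f) d0 - 2 * T (V f) w1 =
   - (T (V f) w1 - T (V f) d0) - (T (V f) w1 - T (V f) (delta x)) by ring.
rewrite h1 h2 !VE lexx [(w1 <= d0)%O]leNgt d0N [(_ <= d0)%O]leNgt d0x.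
rewrite /r /delta (rank_clubN _ cD) (enum_clubK _ cD) mulr1 !mulr0 !addr0 subrr !sub0r.
have -> : val ((1 : boundedOp C) f) x = f x by [].
rewrite -[RHS](mulKf l0); congr (_ * _); ring.
Qed.

Lemma PFP_C_omega1 : PFP C.
Proof.
move=> T; have [l [c [pc hT]]] := jump_eigenvector T.
have [l0|l0] := eqVneq l 0; last by left; exact: factor_of_eigenvalue hT l0.
right; apply: (factor_of_eigenvalue _ (1 - l) _ pc); last by rewrite l0 subr0 oner_eq0.
move=> x cx f; rewrite mulrBl -hT// mul1r.
have E y : (1 - T) f y = f y - T f y by [].
by rewrite !E; ring.
Qed.

End OperatorsOmegaOne.

Theorem theorem2 (R : realType) :
  ((forall E : completeNormedModType R,
      infinite_dimensional E -> PFP E -> dedekind_infinite (boundedOp E)) /\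
   (forall E : completeNormedModType R[i],
      infinite_dimensional E -> PFP E -> dedekind_infinite (boundedOp E))) /\
  (infinite_dimensional (C_omega1 R) /\
   PFP (C_omega1 R) /\
   ~ properly_infinite (boundedOp (C_omega1 R))) /\
  (forall (E : completeNormedModType R[i])
      (E0 : exists x : E, x != 0) (EP : PFP E),
    (forall a : quotAlg E0 EP, a != 0 ->
       exists b c : quotAlg E0 EP, b * a * c = 1) /\
    (purely_infinite (quotAlg E0 EP) <->
     ~ alg_isomorphic (quotAlg E0 EP) R[i]^o)).
Proof.
split; [split=> E Einf EP|split].
- have [x /real_functional [phi bphi phix]] := infinite_dimensional_neq0 E Einf.
  exact: PFP_dedekind_infinite bphi phix Einf EP.
- have [x /complex_functional [phi bphi phix]] := infinite_dimensional_neq0 E Einf.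
  exact: PFP_dedekind_infinite bphi phix Einf EP.
- split; first exact: infinite_dimensional_C_omega1.
  by split; [exact: PFP_C_omega1|exact: not_properly_infinite].
- move=> E E0 EP; split; first exact: quotAlg_factor.
  split=> [[]//|nC]; split=> //; exact: quotAlg_factor.
Qed.
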